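(* Let $n\ge 10$ be a multiple of $5$ and let $m\geq 1$ be an integer. For the bound quiver algebra $\Lambda_{n,m}=kQ_{n,m}/I_{n,m}$ defined in the context, over any field $k$, it holds that $$\mathsf{fin.dim}\,\Lambda_{n,m}^{\mathrm{op}}-\mathsf{Fin.dim}\,\Lambda_{n,m}\ \ge\ m-1 .$$
   Context: Conventions: in the path algebra $kQ$, the product $pq$ of two paths denotes $p$ followed by $q$ (so it is nonzero only if the target of $p$ is the source of $q$). Left modules over $\Lambda$ are the default; $\mathsf{Fin.dim}\,\Lambda$ is the supremum of the projective dimensions of all left $\Lambda$-modules of finite projective dimension, and $\mathsf{fin.dim}\,\Lambda^{\mathrm{op}}$ is the supremum of the projective dimensions of finitely generated right $\Lambda$-modules of finite projective dimension. The quiver $Q_{n,m}$ has vertices $1,2,\dots,n+m$ and the following arrows: $\alpha_i\colon i\to i+1$ for $1\le i\le n-1$, $i\ne5$; two arrows $\alpha_5^1,\alpha_5^2\colon 5\to 6$; $\alpha_n\colon n\to 1$; $\beta_1\colon n+1\to 2$ and $\beta_j\colon n+j\to n+j-1$ for $2\le j\le m$; $\gamma_j\colon 4\to n+j$ for $1\le j\le m$; a loop $\lambda_i\colon i\to i$ for every $1\le i\le n$ with $i\equiv 0$ or $4 \pmod 5$; and a loop $\lambda_{n+m}\colon n+m\to n+m$. The ideal $I_{n,m}$ of $kQ_{n,m}$ is generated by the following relations: (1) $\alpha_{n-2}\alpha_{n-1}\alpha_n$; (2) $\alpha_{n-1}\alpha_n\alpha_1\alpha_2\alpha_3$ and $\alpha_n\alpha_1\alpha_2\alpha_3\alpha_4$;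 (3) $\alpha_i\alpha_{i+1}\alpha_{i+2}\alpha_{i+3}\alpha_{i+4}$ for $1\le i\le n-5$, where $\alpha_5$ is read as $\alpha_5^1$ whenever it occurs; (4) $\alpha_4\alpha_5^1-\alpha_4\alpha_5^2$ and $\alpha_5^1\alpha_6-\alpha_5^2\alpha_6$; (5) $\beta_1\alpha_2$, and $\beta_j\beta_{j-1}$ for $2\le j\le m$; (6) $\gamma_j\beta_j$ for $1\le j\le m$; (7) $\alpha_n\alpha_1\alpha_2\alpha_3\gamma_j$ and $\lambda_4\gamma_j$ for $1\le j\le m$; (8) for every $1\le i\le n$ with $i\equiv 0$ or $4\pmod 5$: $\lambda_i^2$, $\alpha_{i-1}\lambda_i$, and $\lambda_i\alpha_i$, where for $i=5$ the last relation is read as the two relations $\lambda_5\alpha_5^1$ and $\lambda_5\alpha_5^2$; (9) $\lambda_{n+m}^2$, $\gamma_m\lambda_{n+m}$, $\lambda_{n+m}\beta_m$. *)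

(* Defs.v *)
From HB Require Import structures.
From mathcomp Require Import all_boot all_order all_algebra finmap.
From mathcomp Require Import generic_quotient ring_quotient.
From mathcomp.multinomials Require Import monalg.
From mathcomp Require Import boolp classical_sets constructive_ereal.

Set Implicit Arguments.
Unset Strict Implicit.
Unset Printing Implicit Defensive.

Import Order.TTheory GRing.Theory Num.Theory.

Local Open Scope ring_scope.
Local Open Scope quotient_scope.

Record quiver := Quiver {
  vertex : finType;
  arrow : finType;
  source : arrow -> vertex;
  target : arrow -> vertex }.

Section Paths.
Variable Q : quiver.

(* [chain v s]: the arrows of s are composable in the order in which they are
   listed, the first one starting at v. *)
Fixpoint chain (v : vertex Q) (s : seq (arrow Q)) : bool :=
  if s is a :: s' then (source a == v) && chain (target a) s' else true.

Definition chain_end (v : vertex Q) (s : seq (arrow Q)) : vertex Q :=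
  last v (map (@target Q) s).

(* A path is its start vertex with its list of arrows; [(v, [::])] is the
   stationary path at v. *)
Definition qpath := {p : vertex Q * seq (arrow Q) | chain p.1 p.2}.

Definition path_source (p : qpath) : vertex Q := (val p).1.
Definition path_target (p : qpath) : vertex Q := chain_end (val p).1 (val p).2.

Definition vertex_path (v : vertex Q) : qpath := exist _ (v, [::]) isT.

Lemma arrow_path_subproof (a : arrow Q) : chain (source a) [:: a].
Proof. by rewrite /= eqxx. Qed.

Definition arrow_path (a : arrow Q) : qpath :=
  exist _ (source a, [:: a]) (arrow_path_subproof a).

(* [p] followed by [q], when the target of [p] is the source of [q]. *)
Definition path_comp (p q : qpath) : option qpath :=
  if path_target p == path_source q
  then (insub ((val p).1, (val p).2 ++ (val q).2) : option qpath) else None.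

Lemma chain_cat v s t : chain v (s ++ t) = chain v s && chain (chain_end v s) t.
Proof. by elim: s v => //= a s IHs v; rewrite IHs andbA. Qed.

Lemma chain_end_cat v s t :
  chain_end v (s ++ t) = chain_end (chain_end v s) t.
Proof. by rewrite /chain_end map_cat last_cat. Qed.

Lemma path_compA (p q r : qpath) :
  obind (path_comp^~ r) (path_comp p q) = obind (path_comp p) (path_comp q r).
Proof.
case: p q r => [[u s] /= us] [[v t] /= vt] [[w z] /= wz].
rewrite /path_comp /path_target /path_source /=.
case: (eqVneq (chain_end u s) v) => [uv|nuv];
  case: (eqVneq (chain_end v t) w) => [vw|nvw] //=.
- have st : chain u (s ++ t) by rewrite chain_cat us uv.
  have tz : chain v (t ++ z) by rewrite chain_cat vt vw.
  by rewrite !insubT /= chain_end_cat uv vw !eqxx catA.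
- have st : chain u (s ++ t) by rewrite chain_cat us uv.
  by rewrite insubT /= chain_end_cat uv (negPf nvw).
- have tz : chain v (t ++ z) by rewrite chain_cat vt vw.
  by rewrite insubT /= (negPf nuv).
Qed.

Lemma path_comp1p (p : qpath) (v : vertex Q) :
  path_comp (vertex_path v) p = if v == path_source p then Some p else None.
Proof.
case: p => -[u s] us; rewrite /path_comp /path_target /path_source /chain_end /=.
by case: eqP => //= uv; subst; rewrite insubT.
Qed.

Lemma path_compp1 (p : qpath) (v : vertex Q) :
  path_comp p (vertex_path v) = if path_target p == v then Some p else None.
Proof.
case: p => -[u s] us; rewrite /path_comp /path_target /path_source /=.
by rewrite cats0; case: eqP => //= _; rewrite insubT.
Qed.

End Paths.

Definition path_algebra (k : fieldType) (Q : quiver) := {malg k[qpath Q]}.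

HB.instance Definition _ k Q := GRing.Lmodule.on (path_algebra k Q).

HB.lock Definition path_elt (k : fieldType) (Q : quiver) (p : qpath Q) :
  path_algebra k Q := << p >>.

Definition path_mul (k : fieldType) (Q : quiver) (p q : qpath Q) :
  path_algebra k Q := oapp (@path_elt k Q) 0 (path_comp p q).

HB.lock Definition pa_mul (k : fieldType) (Q : quiver)
    (x y : path_algebra k Q) : path_algebra k Q :=
  \sum_(p <- msupp x) \sum_(q <- msupp y) (x@_p * y@_q) *: path_mul k p q.

Section PathAlgebraTheory.
Variables (k : fieldType) (Q : quiver).
Local Notation qpath := (qpath Q).
Local Notation path_algebra := (path_algebra k Q).
Local Notation path_elt := (@path_elt k Q).
Local Notation path_mul := (@path_mul k Q).
Local Notation pa_mul := (@pa_mul k Q).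

Section LinearExtension.
Variables (V : lmodType k) (h : qpath -> V).

Definition lin_ext (x : path_algebra) : V := \sum_(p <- msupp x) x@_p *: h p.

Lemma lin_extE (d : {fset qpath}) (x : path_algebra) :
  (msupp x `<=` d)%fset -> lin_ext x = \sum_(p <- d) x@_p *: h p.
Proof.
move=> le_xd; rewrite /lin_ext.
rewrite [RHS](bigID (fun p => p \in msupp x)) /= [X in _ + X]big1 ?addr0.
  rewrite -[RHS]big_filter; apply: perm_big; apply: uniq_perm.
  - exact: fset_uniq.
  - by rewrite filter_uniq ?fset_uniq.
  - move=> p; rewrite mem_filter.
    by case: (boolP (p \in msupp x)) => //= /(fsubsetP le_xd) ->.
by move=> p /mcoeff_outdom ->; rewrite scale0r.
Qed.

Lemma lin_ext_is_linear : linear lin_ext.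
Proof.
move=> c x y; pose d := (msupp x `|` msupp y `|` msupp (c *: x + y))%fset.
rewrite !(@lin_extE d) /d; last first.
- by rewrite fsubsetU // fsubset_refl orbT.
- by rewrite -fsetUA fsubsetUl.
- by rewrite fsetUAC fsubsetUr.
rewrite scaler_sumr -big_split /=; apply: eq_bigr => p _.
by rewrite mcoeffD mcoeffZ scalerDl scalerA.
Qed.

Lemma lin_ext_elt p : lin_ext (path_elt p) = h p.
Proof.
rewrite unlock (@lin_extE [fset p]%fset) ?msuppU_le //.
by rewrite big_seq_fset1 mcoeffUU scale1r.
Qed.

End LinearExtension.

HB.instance Definition _ (V : lmodType k) (h : qpath -> V) :=
  GRing.isLinear.Build k path_algebra V _ (lin_ext h) (lin_ext_is_linear h).

Lemma path_algebra_ind (P : path_algebra -> Prop) :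
  (forall c x y, P x -> P y -> P (c *: x + y)) -> P 0 ->
  (forall p, P (path_elt p)) -> forall x, P x.
Proof.
move=> Plin P0 Pelt x; rewrite [x]monalgE.
elim: (enum_fset (msupp x)) => [|p s IHs]; first by rewrite big_nil.
rewrite big_cons.
suff -> : << x@_p *g p >> = x@_p *: path_elt p.
  exact: (Plin _ _ _ (Pelt p) IHs).
apply/malgP => q; rewrite mcoeffZ unlock.
rewrite [LHS]mcoeffU [X in _ * X]mcoeffU.
by case: eqP; rewrite ?mulr1 ?mulr0.
Qed.

Lemma pa_mulEl x y :
  pa_mul x y = lin_ext (fun p => lin_ext (path_mul p) y) x.
Proof.
rewrite unlock; apply: eq_bigr => p _; rewrite scaler_sumr; apply: eq_bigr => q _.
by rewrite scalerA.
Qed.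

Lemma pa_mulEr x y :
  pa_mul x y = lin_ext (fun q => lin_ext (path_mul^~ q) x) y.
Proof.
rewrite unlock exchange_big; apply: eq_bigr => q _; rewrite scaler_sumr.
by apply: eq_bigr => p _; rewrite scalerA mulrC.
Qed.

Lemma pa_mulDl c x y z : pa_mul (c *: x + y) z = c *: pa_mul x z + pa_mul y z.
Proof. by rewrite !pa_mulEl linearP. Qed.

Lemma pa_mulDr c x y z : pa_mul z (c *: x + y) = c *: pa_mul z x + pa_mul z y.
Proof. by rewrite !pa_mulEr linearP. Qed.

Lemma pa_mulZl c x y : pa_mul (c *: x) y = c *: pa_mul x y.
Proof. by rewrite !pa_mulEl linearZ. Qed.

Lemma pa_mulZr c x y : pa_mul x (c *: y) = c *: pa_mul x y.
Proof. by rewrite !pa_mulEr linearZ. Qed.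

Lemma pa_mul0l z : pa_mul 0 z = 0. Proof. by rewrite pa_mulEl linear0. Qed.

Lemma pa_mul0r z : pa_mul z 0 = 0. Proof. by rewrite pa_mulEr linear0. Qed.

Lemma pa_mul_elt p q : pa_mul (path_elt p) (path_elt q) = path_mul p q.
Proof. by rewrite pa_mulEl !lin_ext_elt. Qed.

Definition pa_one : path_algebra := \sum_v path_elt (vertex_path v).

Lemma pa_mulA : associative pa_mul.
Proof.
move=> x y z; elim/path_algebra_ind: x => [c x1 x2 IH1 IH2||p].
- rewrite (pa_mulDl c x1 x2 (pa_mul y z)) (pa_mulDl c x1 x2 y).
  rewrite (pa_mulDl c (pa_mul x1 y)) IH1 IH2; reflexivity.
- by rewrite !pa_mul0l.
elim/path_algebra_ind: y => [c y1 y2 IH1 IH2||q].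
- rewrite (pa_mulDl c y1 y2 z) (pa_mulDr c y1 y2 (path_elt p)).
  rewrite (pa_mulDr c (pa_mul y1 z)) (pa_mulDl c (pa_mul (path_elt p) y1)).
  rewrite IH1 IH2; reflexivity.
- by rewrite pa_mul0r !pa_mul0l pa_mul0r.
elim/path_algebra_ind: z => [c z1 z2 IH1 IH2||r].
- rewrite (pa_mulDr c z1 z2 (path_elt q)).
  rewrite (pa_mulDr c (pa_mul (path_elt q) z1)).
  rewrite (pa_mulDr c z1 z2 (pa_mul (path_elt p) (path_elt q))).
  rewrite IH1 IH2; reflexivity.
- by rewrite !pa_mul0r.
rewrite !pa_mul_elt /path_mul; have := path_compA p q r.
case: (path_comp p q) (path_comp q r) => [pq|] [qr|] /= E;
  by rewrite ?pa_mul0l ?pa_mul0r ?pa_mul_elt /path_mul ?E // -E.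
Qed.

Lemma pa_mul1l : left_id pa_one pa_mul.
Proof.
move=> x; elim/path_algebra_ind: x => [c x1 x2 IH1 IH2||p].
- by rewrite pa_mulDr IH1 IH2.
- by rewrite pa_mul0r.
rewrite pa_mulEl linear_sum /= (bigD1 (path_source p)) //= big1 ?addr0.
  by rewrite !lin_ext_elt /path_mul path_comp1p eqxx.
by move=> v /negPf nv; rewrite !lin_ext_elt /path_mul path_comp1p nv.
Qed.

Lemma pa_mul1r : right_id pa_one pa_mul.
Proof.
move=> x; elim/path_algebra_ind: x => [c x1 x2 IH1 IH2||p].
- by rewrite pa_mulDl IH1 IH2.
- by rewrite pa_mul0l.
rewrite pa_mulEr linear_sum /= (bigD1 (path_target p)) //= big1 ?addr0.
  by rewrite !lin_ext_elt /path_mul path_compp1 eqxx.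
by move=> v nv; rewrite !lin_ext_elt /path_mul path_compp1 eq_sym (negPf nv).
Qed.

Lemma pa_mulDlx : left_distributive pa_mul +%R.
Proof. by move=> x y z; rewrite -[x]scale1r pa_mulDl !scale1r. Qed.

Lemma pa_mulDrx : right_distributive pa_mul +%R.
Proof. by move=> z x y; rewrite -[x]scale1r pa_mulDr !scale1r. Qed.

HB.instance Definition _ := GRing.Zmodule_isPzRing.Build path_algebra
  pa_mulA pa_mul1l pa_mul1r pa_mulDlx pa_mulDrx.

Definition arrow_elt (a : arrow Q) : path_algebra := path_elt (arrow_path a).

End PathAlgebraTheory.

Section TwoSidedIdeal.
Variables (R : pzRingType) (S : seq R).

Definition in_ideal (x : R) : Prop :=
  exists2 t : seq (R * R * R), {in t, forall u, u.1.2 \in S}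
    & x = \sum_(u <- t) u.1.1 * u.1.2 * u.2.

Definition ideal_of : {pred R} := fun x => `[< in_ideal x >].

Lemma ideal_ofP x : reflect (in_ideal x) (x \in ideal_of).
Proof. exact: asboolP. Qed.

Lemma ideal_of_zmod_closed : zmod_closed ideal_of.
Proof.
split=> [|_ _ /ideal_ofP[s sS ->] /ideal_ofP[t tS ->]].
  by apply/ideal_ofP; exists [::]; rewrite ?big_nil.
apply/ideal_ofP; exists (s ++ [seq (- u.1.1, u.1.2, u.2) | u <- t]).
  move=> u; rewrite mem_cat => /orP[/sS//|/mapP[v /tS vS ->]]; exact: vS.
rewrite big_cat big_map /= -sumrN; congr (_ + _).
by apply: eq_bigr => u _; rewrite !mulNr.
Qed.

HB.instance Definition _ := GRing.isZmodClosed.Build R ideal_of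
  ideal_of_zmod_closed.

Lemma ideal_ofMl a x : x \in ideal_of -> a * x \in ideal_of.
Proof.
move=> /ideal_ofP[s sS ->]; apply/ideal_ofP.
exists [seq (a * u.1.1, u.1.2, u.2) | u <- s].
  by move=> u /mapP[v /sS vS ->].
by rewrite big_map mulr_sumr; apply: eq_bigr => u _; rewrite !mulrA.
Qed.

Lemma ideal_ofMr a x : x \in ideal_of -> x * a \in ideal_of.
Proof.
move=> /ideal_ofP[s sS ->]; apply/ideal_ofP.
exists [seq (u.1.1, u.1.2, u.2 * a) | u <- s].
  by move=> u /mapP[v /sS vS ->].
by rewrite big_map mulr_suml; apply: eq_bigr => u _; rewrite !mulrA.
Qed.

Lemma ideal_of_gen x : x \in S -> x \in ideal_of.
Proof.
move=> xS; apply/ideal_ofP; exists [:: (1, x, 1)].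
  by move=> u; rewrite inE => /eqP->.
by rewrite big_seq1 mul1r mulr1.
Qed.

Definition quot_ring := Quotient.quot ideal_of.

HB.instance Definition _ := GRing.Zmodule.on quot_ring.

Definition quot_pi (x : R) : quot_ring := \pi_(Quotient.quot ideal_of) x.

Lemma quot_pi_eq x y : (quot_pi x == quot_pi y) = (x - y \in ideal_of).
Proof. by rewrite Quotient.idealrBE. Qed.

Lemma quot_pi_surj (z : quot_ring) : exists x, z = quot_pi x.
Proof. by exists (repr z); rewrite /quot_pi reprK. Qed.

Lemma quot_piD x y : quot_pi (x + y) = quot_pi x + quot_pi y.
Proof. by rewrite /quot_pi !piE. Qed.

Definition quot_one : quot_ring := quot_pi 1.
Definition quot_mul (x y : quot_ring) : quot_ring :=
  quot_pi (repr x * repr y).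

Lemma quot_piM x y : quot_mul (quot_pi x) (quot_pi y) = quot_pi (x * y).
Proof.
apply/eqP; rewrite quot_pi_eq.
set x' := repr _; set y' := repr _.
have xx' : x' - x \in ideal_of by rewrite -quot_pi_eq /quot_pi reprK.
have yy' : y' - y \in ideal_of by rewrite -quot_pi_eq /quot_pi reprK.
have -> : x' * y' - x * y = (x' - x) * y' + x * (y' - y).
  by rewrite mulrBl mulrBr addrA subrK.
by apply: rpredD; [exact: ideal_ofMr | exact: ideal_ofMl].
Qed.

Lemma quot_mulA : associative quot_mul.
Proof.
move=> x y z; have [a ->] := quot_pi_surj x; have [b ->] := quot_pi_surj y.
by have [c ->] := quot_pi_surj z; rewrite !quot_piM mulrA.
Qed.

Lemma quot_mul1x : left_id quot_one quot_mul.
Proof. by move=> x; case: (quot_pi_surj x) => a ->; rewrite quot_piM mul1r. Qed.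

Lemma quot_mulx1 : right_id quot_one quot_mul.
Proof. by move=> x; case: (quot_pi_surj x) => a ->; rewrite quot_piM mulr1. Qed.

Lemma quot_mulDl : left_distributive quot_mul +%R.
Proof.
move=> x y z; have [a ->] := quot_pi_surj x; have [b ->] := quot_pi_surj y.
by have [c ->] := quot_pi_surj z; rewrite -quot_piD !quot_piM -quot_piD mulrDl.
Qed.

Lemma quot_mulDr : right_distributive quot_mul +%R.
Proof.
move=> x y z; have [a ->] := quot_pi_surj x; have [b ->] := quot_pi_surj y.
by have [c ->] := quot_pi_surj z; rewrite -quot_piD !quot_piM -quot_piD mulrDr.
Qed.

HB.instance Definition _ := GRing.Zmodule_isPzRing.Build quot_ring
  quot_mulA quot_mul1x quot_mulx1 quot_mulDl quot_mulDr.

End TwoSidedIdeal.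

Section ExtendedIntegers.
Local Open Scope classical_set_scope.

(* [supremum] and [infimum] return a default value when there is no supremum or
   infimum; for nonempty sets of nonnegative extended integers there is one. *)
Lemma eint_supremums_neq0 (A : set (\bar int)) :
  A !=set0 -> (forall x, A x -> 0%E <= x)%E -> supremums A !=set0.
Proof.
move=> [x0 Ax0] A0; have [[/= x [ubx xfin]]|nub] :=
    pselect (exists x, ubound A x /\ (x < +oo)%E).
  have x0ge : (0 <= x)%E := le_trans (A0 _ Ax0) (ubx _ Ax0).
  pose B : set nat := [set i | A i%:Z%:E].
  have AB y : A y -> exists2 i, B i & y = i%:Z%:E.
    move=> Ay; have := A0 _ Ay; have := le_lt_trans (ubx _ Ay) xfin.
    by case: y Ay => //= -[i|i] // Ai _ _; exists i.
  have [|i [ubi lbi]] := @nat_supremums_neq0 B.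
    case: x ubx xfin x0ge => //= -[i|i] // ubi _ _.
    by exists i => j /ubi; rewrite lee_fin lez_nat.
  exists i%:Z%:E; split=> [y /AB[j Bj ->]|y uby].
    by rewrite lee_fin lez_nat; exact: ubi.
  have := le_trans (A0 _ Ax0) (uby _ Ax0); case: y uby => [[j|j]||] // ubj _.
    rewrite lee_fin lez_nat; apply: lbi => l /ubj; by rewrite lee_fin lez_nat.
exists +oo%E; split=> [y _|y uby]; first exact: leey.
by rewrite leNgt; apply/negP => ylt; apply: nub; exists y.
Qed.

Lemma eint_infimums_neq0 (A : set (\bar int)) :
  A !=set0 -> (forall x, A x -> 0%E <= x)%E -> infimums A !=set0.
Proof.
move=> [x0 Ax0] A0.
have AB y : A y -> (y < +oo)%E -> exists i, y = i%:Z%:E.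
  move=> Ay; have := A0 _ Ay.
  by case: y Ay => //= -[i|i] // Ai _ _; exists i.
have [[i Ai]|nA] := pselect (exists i, A i%:Z%:E).
  have ex : exists i, `[< A i%:Z%:E >] by exists i; apply/asboolP.
  case: (ex_minnP ex) => j /asboolP Aj minj.
  exists j%:Z%:E; split=> [y Ay|y]; last exact.
  have [yfin|] := boolP (y < +oo)%E; last by rewrite ltey negbK => /eqP->; rewrite leey.
  have [l yE] := AB _ Ay yfin; rewrite yE lee_fin lez_nat; apply: minj.
  by apply/asboolP; rewrite -yE.
exists +oo%E; split=> [y Ay|y _]; last exact: leey.
rewrite leNgt; apply/negP => ylt; have [l yE] := AB _ Ay ylt.
by apply: nA; exists l; rewrite -yE.
Qed.

End ExtendedIntegers.

Section Homological.
Variable R : pzRingType.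

Definition surjective_fun (A B : Type) (f : A -> B) := forall y, exists x, f x = y.

Definition projective (P : lmodType R) : Prop :=
  forall (M N : lmodType R) (f : {linear M -> N}) (g : {linear P -> N}),
    surjective_fun f -> exists h : {linear P -> M}, forall x, f (h x) = g x.

(* There is an exact sequence 0 -> P n -> ... -> P 1 -> P 0 -> M -> 0 with
   projective terms; it is indexed by all naturals, with P i = 0 for i > n. *)
Definition has_proj_resolution (M : lmodType R) (n : nat) : Prop :=
  exists (P : nat -> lmodType R) (d : forall i, {linear P i.+1 -> P i})
         (e : {linear P 0 -> M}),
    [/\ forall i, projective (P i),
        surjective_fun e,
        forall x, e x = 0 <-> exists y, d 0 y = x,
        forall i x, d i x = 0 <-> exists y, d i.+1 y = x
      & forall i, (n < i)%N -> forall x : P i, x = 0].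

(* The zero module has projective dimension 0. *)
Definition proj_dim (M : lmodType R) : \bar int :=
  infimum +oo%E [set n%:Z%:E | n in has_proj_resolution M]%classic.

Definition finitely_generated (M : lmodType R) : Prop :=
  exists s : seq M, forall x, exists a : M -> R, x = \sum_(y <- s) a y *: y.

(* Left R-modules are [lmodType R]; right R-modules are [lmodType R^c].
   Since [x - +oo = -oo] in [\bar int], an inequality [z%:E <= x - y] between
   dimensions implies that y is finite. *)
Definition Fin_dim : \bar int :=
  supremum -oo%E
    [set d | exists2 M : lmodType R, (proj_dim M < +oo)%E & d = proj_dim M]%classic.

Definition fin_dim : \bar int :=
  supremum -oo%E
    [set d | exists2 M : lmodType R,
       finitely_generated M /\ (proj_dim M < +oo)%E & d = proj_dim M]%classic.

End Homological.

(* [Alpha5 1] and [Alpha5 2] are the two arrows 5 -> 6. *)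
Inductive label :=
  | Alpha of nat | Alpha5 of nat | Beta of nat | Gamma of nat | Lambda of nat.

Local Open Scope nat_scope.

Definition label_code (l : label) : nat * nat :=
  match l with
  | Alpha i => (0, i) | Alpha5 i => (1, i) | Beta i => (2, i)
  | Gamma i => (3, i) | Lambda i => (4, i)
  end.

Definition label_decode (c : nat * nat) : label :=
  match c with
  | (0, i) => Alpha i | (1, i) => Alpha5 i | (2, i) => Beta i
  | (3, i) => Gamma i | (_, i) => Lambda i
  end.

Lemma label_codeK : cancel label_code label_decode.
Proof. by case. Qed.

HB.instance Definition _ := Countable.copy label (can_type label_codeK).

Section BoundQuiver.
Variables (k : fieldType) (n m : nat).

Definition loop_vertices : seq nat :=
  [seq i <- iota 1 n | (i %% 5 == 0) || (i %% 5 == 4)].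

Definition labels : seq label :=
  [seq Alpha i | i <- iota 1 n & i != 5] ++ [:: Alpha5 1; Alpha5 2]
  ++ [seq Beta j | j <- iota 1 m] ++ [seq Gamma j | j <- iota 1 m]
  ++ [seq Lambda i | i <- loop_vertices] ++ [:: Lambda (n + m)].

Definition label_source (l : label) : nat :=
  match l with
  | Alpha i => i
  | Alpha5 _ => 5
  | Beta j => n + j
  | Gamma _ => 4
  | Lambda i => i
  end.

Definition label_target (l : label) : nat :=
  match l with
  | Alpha i => if i == n then 1 else i + 1
  | Alpha5 _ => 6
  | Beta j => if j == 1 then 2 else n + j - 1
  | Gamma j => n + j
  | Lambda i => i
  end.

(* The vertices 1, ..., n + m are the ordinals 0, ..., n + m - 1. *)
Definition vtx (i : nat) : 'I_(n + m).-1.+1 := inord i.-1.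

Definition Qnm : quiver :=
  @Quiver 'I_(n + m).-1.+1 (seq_sub labels)
    (fun a => vtx (label_source (val a))) (fun a => vtx (label_target (val a))).

(* The arrow with the given label. The default value 0 is not used below when
   n >= 10 is a multiple of 5 and m >= 1. *)
Definition arr (l : label) : path_algebra k Qnm :=
  oapp (@arrow_elt k Qnm) 0%R (insub l : option (seq_sub labels)).

Definition word (s : seq label) : path_algebra k Qnm := (\prod_(l <- s) arr l)%R.

(* alpha_i, where alpha_5 is read as alpha_5^1. *)
Definition al (i : nat) : label := if i == 5 then Alpha5 1 else Alpha i.

Definition relations : seq (path_algebra k Qnm) :=
  [:: word [:: al (n - 2); al (n - 1); al n];
      word [:: al (n - 1); al n; al 1; al 2; al 3];
      word [:: al n; al 1; al 2; al 3; al 4] ]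
  ++ [seq word [:: al i; al (i + 1); al (i + 2); al (i + 3); al (i + 4)]
        | i <- iota 1 (n - 5)]
  ++ [:: (word [:: al 4; Alpha5 1] - word [:: al 4; Alpha5 2])%R;
         (word [:: Alpha5 1; al 6] - word [:: Alpha5 2; al 6])%R ]
  ++ word [:: Beta 1; al 2] :: [seq word [:: Beta j; Beta (j - 1)] | j <- iota 2 (m - 1)]
  ++ [seq word [:: Gamma j; Beta j] | j <- iota 1 m]
  ++ [seq word [:: al n; al 1; al 2; al 3; Gamma j] | j <- iota 1 m]
  ++ [seq word [:: Lambda 4; Gamma j] | j <- iota 1 m]
  ++ [seq word [:: Lambda i; Lambda i] | i <- loop_vertices]
  ++ [seq word [:: al (i - 1); Lambda i] | i <- loop_vertices]
  ++ [seq word [:: Lambda i; al i] | i <- loop_vertices]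
  ++ [:: word [:: Lambda 5; Alpha5 2] ]
  ++ [:: word [:: Lambda (n + m); Lambda (n + m)];
         word [:: Gamma m; Lambda (n + m)];
         word [:: Lambda (n + m); Beta m] ].

Definition Lambda_nm : pzRingType := quot_ring relations.

End BoundQuiver.

(* Main.v *)
(* Every right simple module except the one S_1 at the vertex 1 embeds into the
   algebra, and S_1 has projective dimension D = 2n/5 - 1.  Hence, if a left
   module M has finite projective dimension d > D, all Tor_d(S, M) with S simple
   vanish, so the last map of a projective resolution of length d is injective
   modulo the radical and splits; thus Fin.dim <= D.  On the other side, the
   resolution of the right simple S_2 also has length D, and beta_m, ..., beta_1
   prolong it to a minimal resolution of length m + D - 1 of the simple right
   module generated by beta_m.

   Both resolutions consist of left multiplications r_t satisfying
   r_t r_(t+1) = 0 and: r_t z = 0 only if e z lies in the right ideal of r_(t+1),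
   for the idempotent e at the target of r_t. These conditions pass to projective
   modules, which replaces the use of Tor by a diagram chase. *)

From HB Require Import structures.
Require Import Defs.
From mathcomp Require Import all_boot all_order all_algebra.
From mathcomp Require Import constructive_ereal.
From mathcomp Require Import boolp classical_sets functions zify.
Import Order.TTheory GRing.Theory.
Set Implicit Arguments.
Unset Strict Implicit.
Unset Printing Implicit Defensive.
Local Open Scope ring_scope.

(** The value of D comes from the cycle of alphas. For b = 1, 2, whatever alpha_b annihilates at the
    vertex b+1 starts with the next four alphas, and whatever that path annihilates at its end
    starts with alpha_(b+5), so two steps of the resolution advance by five vertices. This continues
    up to alpha_(n-5+b), where only 5-b alphas remain; they contain the vanishing path alpha_(n-2)
    alpha_(n-1) alpha_n, and the resolution stops. The same relation kills the path of length four
    that would put S_1 into the socle. Thus both sequences have the same length, but of the two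
    vertices only 2 is the target of an arrow, beta_1, that cannot be prolonged; this makes room for
    the tail of betas.

    No basis of the algebra is computed: nonvanishing is read off from functionals on the path
    algebra, one for each start vertex and word, which vanish on the ideal for enough words. The
    lower bound compares an arbitrary resolution with the minimal one up to homotopy, again in terms
    of elements. *)

Lemma dependent_choice (X : Type) (Y : X -> Type) (R : forall x, Y x -> Prop) :
  (forall x, exists y, R x y) -> exists f : forall x, Y x, forall x, R x (f x).
Proof.
by move=> RY; exists (fun x => sval (cid (RY x))) => x; case: cid.
Qed.

(** * Submodules, lifting and projective modules *)

Section Modules.
Variable A : pzRingType.

Lemma linear_of (U V : lmodType A) (f : U -> V) :
  linear f -> exists g : {linear U -> V}, g =1 f.
Proof.
move=> fL; pose L := GRing.isLinear.Build A U V _ f fL.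
pose F : {linear U -> V} := HB.pack f L.
by exists F.
Qed.

(** Kernels, pullbacks and the terms of the explicit resolution are all obtained in this way from a
    closed predicate; later arguments see only the injection. *)
Lemma submodule_of (V : lmodType A) (S : V -> Prop) :
  S 0 -> (forall a x y, S x -> S y -> S (a *: x + y)) ->
  exists (W : lmodType A) (i : {linear W -> V}),
    injective i /\ forall x, S x <-> exists w, i w = x.
Proof.
move=> S0 SL; pose p : {pred V} := fun x => `[< S x >].
have pL : submod_closed p.
  split=> [|a x y /asboolP Sx /asboolP Sy]; first exact/asboolP.
  by apply/asboolP; exact: SL.
pose pB := GRing.isSubmodClosed.Build A V p pL.
pose pS : submodClosed V := HB.pack p pB.
pose sB := [SubChoice_isSubLmodule of {x | x \in pS} by <:].
pose W : lmodType A := HB.pack {x | x \in pS} sB.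
have vL : linear (val : W -> V) by move=> a x y.
have [i iE] := linear_of vL; exists W, i; split=> [x y|x].
  by rewrite !iE => /val_inj.
split=> [Sx|[w <-]]; last by rewrite iE; apply/asboolP; exact: (valP w).
have px : x \in pS by apply/asboolP.
by exists (exist _ x px); rewrite iE.
Qed.

Lemma factor_surj (U V W : lmodType A) (e : {linear U -> V}) (h : {linear U -> W}) :
  surjective_fun e -> (forall x, e x = 0 -> h x = 0) ->
  exists g : {linear V -> W}, forall x, g (e x) = h x.
Proof.
move=> /choice[s sK] eh.
have hs x : h (s (e x)) = h x.
  by apply/eqP; rewrite -subr_eq0 -linearB; apply/eqP/eh; rewrite linearB sK subrr.
have gL : linear (fun y => h (s y)).
  move=> a x y; rewrite -linearP /=.
  by rewrite -(hs (a *: s x + s y)) linearP !sK.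
by have [g gE] := linear_of gL; exists g => x; rewrite gE.
Qed.

Lemma factor_inj (U V W : lmodType A) (i : {linear U -> V}) (h : {linear W -> V}) :
  injective i -> (forall x, exists y, i y = h x) ->
  exists g : {linear W -> U}, forall x, i (g x) = h x.
Proof.
move=> iI /choice[g gE].
have gL : linear g by move=> a x y; apply: iI; rewrite linearP !gE linearP.
by have [g' g'E] := linear_of gL; exists g' => x; rewrite g'E.
Qed.

(** The pullback of [f] along the composite of [h] and [g] maps onto [P] as soon as the images are
    contained in that of [f]. A section of this surjection exists, and its first component is the
    lift. *)
Lemma projective_lift (P U V W : lmodType A) (f : {linear U -> W})
    (g : {linear V -> W}) (h : {linear P -> V}) :
  projective P -> (forall x, exists y, f y = g (h x)) ->
  exists l : {linear P -> U}, forall x, f (l x) = g (h x).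
Proof.
move=> Pproj fgh.
pose S (z : U * P) := f z.1 = g (h z.2).
have [||M [i [_ iS]]] := @submodule_of (U * P)%type S.
- by rewrite /S /= !linear0.
- by move=> a x y; rewrite /S /= => Sx Sy; rewrite !linearP Sx Sy.
have qL : linear (fun x : M => (i x).2) by move=> a x y; rewrite linearP.
have [q qE] := linear_of qL.
have iL : linear (idfun : P -> P) by [].
have [j jE] := linear_of iL.
have qs : surjective_fun q.
  move=> x; have [y fy] := fgh x.
  have /iS[w wE] : S (y, x) by [].
  by exists w; rewrite qE wE.
have [s sE] := Pproj _ _ q j qs.
have lL : linear (fun x => (i (s x)).1) by move=> a x y; rewrite !linearP.
have [l lE] := linear_of lL; exists l => x.
have : S (i (s x)) by apply/iS; exists (s x).
by rewrite /S lE => ->; rewrite -qE sE jE.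
Qed.

Lemma projective_retract (P Q : lmodType A) (i : {linear Q -> P})
    (r : {linear P -> Q}) :
  projective P -> (forall x, r (i x) = x) -> projective Q.
Proof.
move=> Pproj rK M N f g fs.
have gL : linear (fun x => g (r x)) by move=> a x y; rewrite !linearP.
have [g' g'E] := linear_of gL.
have [h hE] := Pproj _ _ f g' fs.
have hL : linear (fun x => h (i x)) by move=> a x y; rewrite !linearP.
by have [h' h'E] := linear_of hL; exists h' => x; rewrite h'E hE g'E rK.
Qed.

Lemma projective_trivial (P : lmodType A) : (forall x : P, x = 0) -> projective P.
Proof.
move=> P0 M N f g _.
have zL : linear (fun _ : P => 0 : M) by move=> a x y; rewrite scaler0 addr0.
by have [h hE] := linear_of zL; exists h => x; rewrite hE (P0 x) !linear0.
Qed.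

Lemma principal_projective (P : lmodType A) (e : A) (u : P)
    (i : {linear P -> A^o}) :
  injective i -> i u = e -> e * e = e ->
  (forall x, exists a : A, i x = a * e) -> projective P.
Proof.
move=> iI iu ee iP M N f g fs; have [m fm] := fs (g u).
have hL : linear (fun x : P => (i x : A) *: m).
  by move=> a x y; rewrite linearP /= scalerDl -scalerA.
have [h hE] := linear_of hL; exists h => x; rewrite hE linearZ /= fm -linearZ.
congr (g _); apply: iI; rewrite linearZ iu; have [a ->] := iP x.
by rewrite -[LHS]/(a * e * e) -mulrA ee.
Qed.

(* The coefficients of the splitting of the canonical surjection from the free
   module on the set P. *)
Lemma dual_basis (P : lmodType A) : projective P ->
  exists (c : P -> P -> A) (D : P -> seq P),
    (forall a x p, c (a *: x) p = a * c x p) /\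
    forall x, x = \sum_(p <- D x) c x p *: p.
Proof.
move=> Pproj.
pose coef (t : seq (A * P)) : P -> A^o := fun p => \sum_(u <- t | u.2 == p) u.1.
pose S (z : (P -> A^o) * P) := exists t : seq (A * P),
  z = (coef t, \sum_(u <- t) u.1 *: u.2).
have [||M [i [_ iS]]] := @submodule_of ((P -> A^o) * P)%type S.
- exists [::]; rewrite big_nil; congr pair; apply/funext => p.
  by rewrite /coef big_nil.
- move=> a _ _ [t1 ->] [t2 ->].
  exists ([seq (a * u.1, u.2) | u <- t1] ++ t2).
  rewrite big_cat big_map /=; congr pair.
    apply/funext => p; rewrite -[LHS]/(a * coef t1 p + coef t2 p) /coef.
    by rewrite big_cat big_map /= mulr_sumr.
  rewrite -[LHS]/(a *: (\sum_(u <- t1) _) + \sum_(u <- t2) _) scaler_sumr.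
  by congr (_ + _); apply: eq_bigr => u _; rewrite scalerA.
have qL : linear (fun x : M => (i x).2) by move=> a x y; rewrite linearP.
have [q qE] := linear_of qL.
have iL : linear (idfun : P -> P) by [].
have [j jE] := linear_of iL.
have qs : surjective_fun q.
  move=> x; have /iS[w wE] : S (coef [:: (1, x)], x).
    by exists [:: (1, x)]; rewrite big_seq1 /= scale1r.
  by exists w; rewrite qE wE.
have [s sE] := Pproj _ _ q j qs.
exists (fun x => (i (s x)).1).
suff /choice[D DE] : forall x, exists D : seq P,
    x = \sum_(p <- D) ((i (s x)).1 p : A) *: p.
  by exists D; split=> // a x p; rewrite !linearZ.
move=> x; have /iS[t tE] : exists w, i w = i (s x) by exists (s x).
exists (undup [seq u.2 | u <- t]); rewrite tE /= -{1}[x]jE -sE qE tE /=.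
under [RHS]eq_bigr => p _ do rewrite /coef scaler_suml big_mkcond.
rewrite exchange_big /= big_seq [RHS]big_seq; apply: eq_bigr => u ut.
rewrite -big_mkcond /= -big_filter.
under eq_filter => p do rewrite eq_sym.
rewrite filter_pred1_uniq ?undup_uniq //.
  by rewrite big_seq1.
by rewrite mem_undup; apply/mapP; exists u.
Qed.

(** The coordinates of a dual basis commute with left multiplication, so [r *: x = 0] implies that
    [r] kills every coordinate of [x], and the hypothesis on [A] applies to each of them. This is
    the flatness of [P] in terms of elements. *)
Lemma projective_annihilator (P : lmodType A) (r e : A) (J : finType) (s : J -> A) :
  projective P ->
  (forall z, r * z = 0 -> exists y : J -> A, e * z = \sum_j s j * y j) ->
  forall x : P, r *: x = 0 -> exists y : J -> P, e *: x = \sum_j s j *: y j.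
Proof.
move=> /dual_basis[c [D [cZ xE]]] rs x rx.
have c0 p : c 0 p = 0 by rewrite -(scale0r (0 : P)) cZ mul0r.
have /choice[y yE] p : exists y : J -> A, e * c x p = \sum_j s j * y j.
  by apply: rs; rewrite -cZ rx c0.
exists (fun j => \sum_(p <- D x) y p j *: p).
rewrite {1}[x]xE scaler_sumr.
under [RHS]eq_bigr => j _ do rewrite scaler_sumr.
rewrite exchange_big; apply: eq_bigr => p _ /=.
by rewrite scalerA yE scaler_suml; apply: eq_bigr => j _; rewrite scalerA.
Qed.

Lemma projective_annihilator1 (P : lmodType A) (r e s : A) : projective P ->
  (forall z, r * z = 0 -> exists y, e * z = s * y) ->
  forall x : P, r *: x = 0 -> exists y, e *: x = s *: y.
Proof.
move=> Pproj rs x rx.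
have sum1 (M : zmodType) (F : 'I_1 -> M) : \sum_i F i = F ord0 by exact: big_ord1.
have [z /rs[y yE]|y yE] :=
    projective_annihilator (e := e) (s := fun _ : 'I_1 => s) Pproj _ rx.
  by exists (fun=> y); rewrite sum1.
by exists (y ord0); rewrite yE sum1.
Qed.

End Modules.

(** * Splitting modulo a nilpotent radical *)

Section Radical.
Variables (A : pzRingType) (I V : finType) (a : I -> A) (e : V -> A) (L : nat).

Definition in_rad (P : lmodType A) (x : P) : Prop :=
  exists y : I -> P, x = \sum_i a i *: y i.

Lemma in_rad0 (P : lmodType A) : in_rad (0 : P).
Proof. by exists (fun=> 0); rewrite big1 // => i _; rewrite scaler0. Qed.

Lemma in_radD (P : lmodType A) (x y : P) : in_rad x -> in_rad y -> in_rad (x + y).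
Proof.
move=> [u ->] [v ->]; exists (fun i => u i + v i).
by rewrite -big_split; apply: eq_bigr => i _; rewrite scalerDr.
Qed.

Lemma in_rad_sum (P : lmodType A) (J : finType) (x : J -> P) :
  (forall j, in_rad (x j)) -> in_rad (\sum_j x j).
Proof.
move=> rx; elim/big_ind: _ => //; [exact: in_rad0 | exact: in_radD].
Qed.

Lemma in_rad_scale (P : lmodType A) (b : A) (x : P) :
  in_rad (b : A^o) -> in_rad (b *: x).
Proof.
move=> [y ->]; exists (fun i => (y i : A) *: x).
by rewrite scaler_suml; apply: eq_bigr => i _; rewrite scalerA.
Qed.

Hypothesis rad_ideal : forall (b : A) i, in_rad (b * a i : A^o).
Hypothesis rad_semisimple : forall (b : A) v,
  in_rad (b * e v : A^o) \/ exists b', in_rad (b' * b * e v - e v : A^o).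
Hypothesis sum_vertices : \sum_v e v = 1.
Hypothesis rad_nilpotent : forall s : seq I, size s = L -> \prod_(i <- s) a i = 0.

Lemma in_radZ (P : lmodType A) (b : A) (x : P) : in_rad x -> in_rad (b *: x).
Proof.
move=> [y ->]; rewrite scaler_sumr; apply: in_rad_sum => i; rewrite scalerA.
exact/in_rad_scale/rad_ideal.
Qed.

(** This is rad^l P, with one generator split off on the left at each step. *)
Fixpoint in_rad_pow (P : lmodType A) (l : nat) (x : P) : Prop :=
  if l is l'.+1 then
    exists y : I -> P, (forall i, in_rad_pow l' (y i)) /\ x = \sum_i a i *: y i
  else True.

Lemma in_rad_pow_nilpotent (P : lmodType A) (x : P) : in_rad_pow L x -> x = 0.
Proof.
move=> xL; suff H l s : (size s + l)%N = L -> forall y : P, in_rad_pow l y ->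
    (\prod_(i <- s) a i) *: y = 0.
  by have := H L [::] erefl x xL; rewrite big_nil scale1r.
elim: l s => [|l IHl] s.
  by rewrite addn0 => /rad_nilpotent-> y _; rewrite scale0r.
move=> sL _ [z [zl ->]]; rewrite scaler_sumr big1 // => i _.
have := IHl (rcons s i) _ (z i) (zl i).
by rewrite size_rcons addSnnS => /(_ sL); rewrite big_rcons /= scalerA.
Qed.

(* A complement of f(P) modulo the radical exists by Zorn's lemma; lifting the
   projection along it gives a left inverse of f modulo the radical, hence a
   true one because the radical is nilpotent. *)
Lemma split_mod_rad (P Q : lmodType A) (f : {linear P -> Q}) :
  projective Q -> (forall p, in_rad (f p) -> in_rad p) ->
  exists g : {linear Q -> P}, forall p, g (f p) = p.
Proof.
move=> Qproj frad.
pose ok (N : Q -> Prop) := [/\ forall x, in_rad x -> N x,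
  forall b x y, N x -> N y -> N (b *: x + y) & forall p, N (f p) -> in_rad p].
pose T := {N : Q -> Prop | ok N}.
pose le (N1 N2 : T) := `[< forall x, sval N1 x -> sval N2 x >].
have ok_rad : ok (@in_rad Q).
  by split=> // b x y rx ry; apply: in_radD => //; exact: in_radZ.
have [||F tot|[N okN] maxN] :=
    @ZL_preorder T (exist ok _ ok_rad) le.
- by move=> t; exact/asboolP.
- by move=> r s t /asboolP rs /asboolP st; apply/asboolP => x /rs /st.
- pose U x := in_rad x \/ exists N : T, F N /\ sval N x.
  have okU : ok U.
    split; first by left.
      move=> b x y; have radF (N : T) z : in_rad z -> sval N z.
        by case: N => N [Nr ? ?] /= /Nr.
      have lF (N : T) (u v : Q) : sval N u -> sval N v -> sval N (b *: u + v).
        by case: N => N [? NL ?] /=; exact: NL.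
      case=> [rx|[N1 [F1 x1]]]; case=> [ry|[N2 [F2 y2]]].
      + by left; apply: in_radD => //; exact: in_radZ.
      + by right; exists N2; split=> //; apply: lF => //; exact: radF.
      + by right; exists N1; split=> //; apply: lF => //; exact: radF.
      + case: (tot _ _ F1 F2) => /asboolP le12; right.
          by exists N2; split=> //; apply: lF => //; exact: le12.
        by exists N1; split=> //; apply: lF => //; exact: le12.
    by move=> p [/frad//|[[N [? ? Nf]] /= [_ /Nf]]].
  exists (exist ok U okU) => s Fs; apply/asboolP => x sx /=.
  by right; exists s.
have [Nrad NL Nf] := okN.
have N0 : N 0 by apply: Nrad; exact: in_rad0.
have ND x y : N x -> N y -> N (x + y) by move=> Nx Ny; rewrite -[x]scale1r; exact: NL.
have NZ b x : N x -> N (b *: x) by move=> Nx; rewrite -[_ *: _]addr0; exact: NL.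
have cover_vertex v x : exists p, N (e v *: x - f p).
  apply: contrapT => /forallNP nNx.
  (* N' is N + A e_v x. It still meets f(P) only in the image of the radical: if f p lies in b e_v x
     + N and b e_v is not in the radical, inverting b at v puts e_v x into N + f(P). *)
  pose N' y := exists b, N (y - b *: (e v *: x)).
  have okN' : ok N'.
    split=> [y /Nrad Ny|b y z [c Nc] [d Nd]|p [b Nb]].
    - by exists 0; rewrite scale0r subr0.
    - exists (b * c + d); have := ND _ _ (NZ b _ Nc) Nd.
      by rewrite scalerBr addrACA -opprD (scalerDl (e v *: x)) -(scalerA b c).
    have [bev|[b' b'ev]] := rad_semisimple b v.
      apply: Nf; rewrite -(subrK (b *: (e v *: x)) (f p)); apply: ND => //.
      by apply: Nrad; rewrite scalerA; exact: in_rad_scale.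
    exfalso; apply: (nNx (b' *: p)).
    have := ND _ _ (NZ (- b') _ Nb) (Nrad _ (in_rad_scale (- x) b'ev)).
    suff -> : - b' *: (f p - b *: (e v *: x)) + (b' * b * e v - e v : A) *: - x =
      e v *: x - f (b' *: p) by [].
    rewrite [f (b' *: p)]linearZ /= (scalerBr (- b')) !scaleNr scalerN.
    rewrite scalerBl !scalerA !opprK.
    by rewrite mulrA opprB [LHS]addrC [X in _ + X]addrC addrA subrK.
  have NN' : le (exist ok N okN) (exist ok N' okN').
    by apply/asboolP => y Ny /=; exists 0; rewrite scale0r subr0.
  have /asboolP/= N'N := maxN _ NN'; apply: (nNx 0).
  by rewrite linear0 subr0; apply: N'N; exists 1; rewrite scale1r subrr.
have cover x : exists p, N (x - f p).
  have /choice[p pE] v := cover_vertex v x.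
  exists (\sum_v p v); rewrite linear_sum -[x]scale1r -sum_vertices scaler_suml.
  by rewrite -sumrB; elim/big_ind: _ => // v _; exact: pE.
(* Pairs (x, p) with x in f p + N: a section of the first projection chooses p linearly in x. *)
have [||M [i [_ iM]]] := @submodule_of A (Q * P)%type (fun z => N (z.1 - f z.2)).
- by rewrite /= linear0 subr0.
- move=> b x y /= Nx Ny; rewrite linearP /= opprD addrACA -scalerBr.
  exact: NL.
have qL : linear (fun x : M => (i x).1) by move=> b x y; rewrite linearP.
have [q qE] := linear_of qL.
have idL : linear (idfun : Q -> Q) by [].
have [j jE] := linear_of idL.
have qs : surjective_fun q.
  by move=> x; have [p /(iM (x, p))[w wE]] := cover x; exists w; rewrite qE wE.
have [s sE] := Qproj _ _ q j qs.
have gL : linear (fun x => (i (s x)).2) by move=> b x y; rewrite !linearP.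
have [g gE] := linear_of gL.
have gN x : N (x - f (g x)).
  have : N ((i (s x)).1 - f (i (s x)).2) by apply/iM; exists (s x).
  by rewrite -qE sE jE -gE.
have grad p : in_rad (p - g (f p)).
  by apply: Nf; rewrite linearB; exact: gN.
suff H l : exists gl : {linear Q -> P}, forall p, in_rad_pow l (p - gl (f p)).
  have [gl glE] := H L; exists gl => p; apply/esym/eqP; rewrite -subr_eq0; apply/eqP.
  exact: in_rad_pow_nilpotent.
elim: l => [|l [gl glE]]; first by exists g.
(* For this map h one has 1 - h f = (1 - g f)(1 - gl f), and 1 - g f gains one more power of the
   radical. *)
have hL : linear (fun x => gl x + g x - g (f (gl x))).
  move=> b x y; rewrite (linearP gl) (linearP f) !(linearP g) /= scalerBr.
  rewrite scalerDr opprD.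
  by rewrite (addrACA (b *: gl x)) (addrACA (b *: gl x + _)).
have [h hE] := linear_of hL; exists h => p; rewrite hE.
have -> : p - (gl (f p) + g (f p) - g (f (gl (f p)))) =
    (p - gl (f p)) - g (f (p - gl (f p))).
  by rewrite (linearB f) (linearB g) -(addrA (gl (f p))) opprD addrA.
elim: l (p - _) {glE} (glE p) => [|l IHl] u /=.
  by move=> _; have [y ->] := grad u; exists y.
move=> [y [yl ->]]; exists (fun i => y i - g (f (y i))); split=> [k|].
  exact: IHl.
rewrite (linear_sum f) (linear_sum g) -sumrB; apply: eq_bigr => k _.
by rewrite [f (_ *: _)]linearZ [g (_ *: _)]linearZ /= -scalerBr.
Qed.
End Radical.

(** * Projective resolutions *)

Section Resolutions.
Variable A : pzRingType.

Definition resolution (M : lmodType A) (P : nat -> lmodType A)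
    (d : forall i, {linear P i.+1 -> P i}) (e : {linear P 0 -> M}) : Prop :=
  [/\ forall i, projective (P i), surjective_fun e,
      forall x, e x = 0 <-> exists y, d 0 y = x
    & forall i x, d i x = 0 <-> exists y, d i.+1 y = x].

Definition vanishes_above (P : nat -> lmodType A) n :=
  forall i, (n < i)%N -> forall x : P i, x = 0.

Lemma syzygy (M : lmodType A) (P : nat -> lmodType A)
    (d : forall i, {linear P i.+1 -> P i})
    (e : {linear P 0 -> M}) : resolution d e ->
  exists (K : lmodType A) (i : {linear K -> P 0}) (e' : {linear P 1 -> K}),
    [/\ injective i, forall x, e x = 0 <-> exists k, i k = x
      & resolution (fun j => d j.+1) e'].
Proof.
move=> [Pproj es e0 ex].
have [||K [i [iI iK]]] := @submodule_of A (P 0) (fun x => e x = 0).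
- exact: linear0.
- by move=> a x y ex0 ey0; rewrite linearP ex0 ey0 scaler0 addr0.
have [|e' ie'] := factor_inj (h := d 0) iI.
  by move=> y; apply/iK/e0; exists y.
exists K, i, e'; split=> //; split=> //.
- move=> k; have /e0[y dy] : e (i k) = 0 by apply/iK; exists k.
  by exists y; apply: iI; rewrite ie'.
- move=> x; rewrite -ex -ie'; split=> [->|]; first exact: linear0.
  by move=> ix; apply: iI; rewrite ix linear0.
Qed.

Lemma resolution_cons (M K P0 : lmodType A) (i : {linear K -> P0})
    (e : {linear P0 -> M}) n :
  projective P0 -> injective i -> surjective_fun e ->
  (forall x, e x = 0 <-> exists k, i k = x) ->
  has_proj_resolution K n -> has_proj_resolution M n.+1.
Proof.
move=> P0proj iI es eK [P [d [f [Pproj fs f0 dE Pn]]]].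
have iL : linear (fun x => i (f x)) by move=> a x y; rewrite !linearP.
have [g gE] := linear_of iL.
pose P' j := if j is j'.+1 then P j' else P0.
pose d' j : {linear P' j.+1 -> P' j} :=
  match j return {linear P' j.+1 -> P' j} with 0 => g | j'.+1 => d j' end.
exists P', d', e; split=> //.
- by case.
- move=> x; split=> [/eK[k <-]|[y /= <-]].
    by have [y <-] := fs k; exists y; rewrite /= gE.
  by apply/eK; exists (f y); rewrite gE.
- case=> [|j] x; last exact: dE.
  rewrite -f0 /= gE; split=> [ifx|->]; last exact: linear0.
  by apply: iI; rewrite ifx linear0.
- by case=> // j jn; apply: Pn.
Qed.

Lemma projective_resolution0 (M : lmodType A) :
  projective M -> has_proj_resolution M 0.
Proof.
move=> Mproj.
have [||Z [i [iI iZ]]] := @submodule_of A M (fun x => x = 0) => //.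
  by move=> a x y -> ->; rewrite scaler0 addr0.
have Z0 (z : Z) : z = 0 by apply: iI; rewrite linear0; apply/iZ; exists z.
have idL : linear (idfun : M -> M) by [].
have [e eE] := linear_of idL.
have zL : linear (fun _ : Z => 0 : Z) by move=> a x y; rewrite scaler0 addr0.
have [z zE] := linear_of zL.
pose P' j := if j is j'.+1 then Z else M.
pose d' j : {linear P' j.+1 -> P' j} :=
  match j return {linear P' j.+1 -> P' j} with 0 => i | j'.+1 => z end.
exists P', d', e; split=> //.
- by case=> //= _; exact: projective_trivial.
- by move=> x; exists x; rewrite eE.
- by move=> x; rewrite eE; exact: iZ.
- case=> [|j] x /=; rewrite (Z0 x); split=> _.
  + by exists (0 : Z); exact: Z0.
  + exact: (linear0 i).
  + by exists (0 : Z); exact: Z0.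
  + exact: Z0.
- by case.
Qed.

(** In degree 0 the map [x - d 0 (g x)] kills the image of [d 0], so it descends to a section of
    [e], and [M] is a retract of [P 0]. Higher degrees reduce to this one by passing to syzygies. *)
Lemma split_resolution n (M : lmodType A) (P : nat -> lmodType A)
    (d : forall i, {linear P i.+1 -> P i})
    (e : {linear P 0 -> M}) (g : {linear P n -> P n.+1}) :
  resolution d e -> (forall x, g (d n x) = x) -> has_proj_resolution M n.
Proof.
elim: n M P d e g => [|n IHn] M P d e g res gK; last first.
  have [K [i [e' [iI iK res']]]] := syzygy res.
  have [Pproj es _ _] := res.
  apply: (resolution_cons (Pproj 0%N) iI es iK).
  exact: (IHn K (fun j => P j.+1) (fun j => d j.+1) e' g).
have [Pproj es e0 _] := res; apply: projective_resolution0.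
have hL : linear (fun x => x - d 0 (g x)).
  move=> a x y; rewrite (linearP g) (linearP (d 0)) opprD addrACA.
  by rewrite scalerBr.
have [h hE] := linear_of hL.
have [x /e0[y <-]|s sE] := factor_surj es (h := h).
  by rewrite hE gK subrr.
apply: (projective_retract (i := s) (r := e) (Pproj 0%N)) => y.
have [x <-] := es y; rewrite sE hE linearB.
have -> : e (d 0 (g x)) = 0 by apply/e0; exists (g x).
by rewrite subr0.
Qed.

(** Taking syzygies moves the end of a resolution of length j + 1 > D to degree D + 1, where the
    hypothesis splits the last map; this shortens the resolution by one, and the argument is
    repeated down to D. *)
Lemma shorten_resolutions (D : nat) :
  (forall (M : lmodType A) (P : nat -> lmodType A)
    (d : forall i, {linear P i.+1 -> P i})
     (e : {linear P 0 -> M}), resolution d e -> vanishes_above P D.+1 ->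
     exists g : {linear P D -> P D.+1}, forall x, g (d D x) = x) ->
  forall (M : lmodType A) n, has_proj_resolution M n ->
    has_proj_resolution M (minn n D).
Proof.
move=> splitD M n; elim: n M => [|n IHn] M; first by rewrite min0n.
have step (N : lmodType A) j : (D <= j)%N -> has_proj_resolution N j.+1 ->
    has_proj_resolution N j.
  elim: j N => [|j IHj] N.
    rewrite leqn0 => /eqP D0; move: splitD; rewrite D0 => split0.
    move=> [P [d [e [Pp es e0 dE PD]]]].
    have res : resolution d e by split.
    by have [g gK] := split0 _ _ _ _ res PD; apply: (split_resolution res gK).
  rewrite leq_eqVlt => /predU1P[D1|Dj] [P [d [e [Pp es e0 dE PD]]]].
    have res : resolution d e by split.
    move: splitD; rewrite D1 => splitD.
    by have [g gK] := splitD _ _ _ _ res PD; apply: (split_resolution res gK).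
  have res : resolution d e by split.
  have [K [i [e' [iI iK [Pp' es' e0' dE']]]]] := syzygy res.
  apply: (resolution_cons (Pp 0%N) iI es iK); apply: IHj => //.
  by exists (fun j => P j.+1), (fun j => d j.+1), e'; split=> // l jl; apply: PD.
move=> Mn; case: (leqP D n) => Dn; last by rewrite (minn_idPl _).
rewrite (minn_idPr _) 1?leqW //; have := IHn M (step M n Dn Mn).
by rewrite (minn_idPr _).
Qed.

End Resolutions.

(** * Upper bound for finite projective dimensions *)

Section UpperBound.
Variables (A : pzRingType) (I V : finType) (a : I -> A) (e : V -> A) (L : nat).

Hypothesis rad_ideal : forall (b : A) i, in_rad a (b * a i : A^o).
Hypothesis rad_semisimple : forall (b : A) v,
  in_rad a (b * e v : A^o) \/ exists b', in_rad a (b' * b * e v - e v : A^o).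
Hypothesis sum_vertices : \sum_v e v = 1.
Hypothesis rad_nilpotent : forall s : seq I, size s = L -> \prod_(i <- s) a i = 0.

Variables (v0 : V) (r s : nat -> A) (D : nat).
Hypothesis r_last : r D = 0.
Hypothesis r_complex : forall t, (t < D)%N -> r t * r t.+1 = 0.
Hypothesis r_target : forall t, (t < D)%N -> r t * s t = r t.
Hypothesis r_exact : forall t z, (t < D)%N -> r t * z = 0 ->
  exists y, s t * z = r t.+1 * y.
Hypothesis r_first : in_rad a (r 0%N : A^o).
Hypothesis r_arrows : forall i, exists y, e v0 * a i = r 0%N * y.
Hypothesis socle : forall v, v != v0 -> exists x,
  [/\ x * e v = x, forall i, x * a i = 0
    & forall z, x * z = 0 -> in_rad a (e v * z : A^o)].

(* This is the vanishing of Tor against the right module with projective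
   resolution given by left multiplication by the r t, in terms of elements. *)
Lemma boundary_chase (M : lmodType A) (P : nat -> lmodType A)
    (d : forall i, {linear P i.+1 -> P i}) (f : {linear P 0 -> M}) :
  resolution d f -> forall t j (q : P j) (x : P j.+1),
  (t <= D <= t + j)%N -> d j x = r t *: q ->
  exists q', r t *: q = d j (r t *: q').
Proof.
move=> [Pproj _ _ dE] t j; elim: j t => [|j IHj] t q x /andP[tD Dtj] dx.
  have -> : t = D by lia.
  by exists 0; rewrite r_last !scale0r linear0.
move: tD; rewrite leq_eqVlt => /predU1P[->|tD].
  by exists 0; rewrite r_last !scale0r linear0.
have rdq : r t *: d j q = 0.
  by rewrite -linearZ /= -dx; apply/dE; exists x.
(* The element [d j q] is killed by [r t]; exactness in [P j] turns it into a multiple of [r t.+1],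
   which is the same problem one degree lower with the same t + j. *)
have [z /(r_exact tD)//|y sq] :=
  projective_annihilator1 (e := s t) (s := r t.+1) (Pproj j) _ rdq.
have [||q2 q2E] := IHj t.+1 y (s t *: q); first by lia.
  by rewrite linearZ.
have : d j (s t *: q - r t.+1 *: q2) = 0.
  by rewrite linearB -q2E linearZ /= sq subrr.
move=> /dE[q3 q3E]; exists q3.
rewrite linearZ /= q3E scalerBr !scalerA r_target // r_complex // scale0r.
by rewrite subr0.
Qed.

(** At a vertex other than [v0] a socle element x kills the radical, so x (d p) = 0, and injectivity
    of the last map gives x p = 0. At [v0] all arrows lie in r_0 A, so d (e_v0 p) = r_0 q, and the
    chase rewrites this as d (r_0 q'), whence e_v0 p = r_0 q'. *)
Lemma last_map_minimal (M : lmodType A) (P : nat -> lmodType A)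
    (d : forall i, {linear P i.+1 -> P i}) (f : {linear P 0 -> M}) :
  resolution d f -> vanishes_above P D.+1 ->
  forall p, in_rad a (d D p) -> in_rad a p.
Proof.
move=> res PD p dp; have [Pproj _ _ dE] := res.
have dI x : d D x = 0 -> x = 0.
  by move=> /dE[y <-]; rewrite (PD _ _ y) // linear0.
rewrite -[p]scale1r -sum_vertices scaler_suml; apply: in_rad_sum => v.
case: (eqVneq v v0) => [->|/socle[x [xv xa xz]]].
  have [q qE] : exists q, d D (e v0 *: p) = r 0%N *: q.
    have [y yE] := dp; have [y' y'E] := choice r_arrows.
    exists (\sum_i y' i *: y i); rewrite linearZ /= yE !scaler_sumr.
    by apply: eq_bigr => i _; rewrite !scalerA y'E.
  have [|q' q'E] := boundary_chase res (t := 0%N) _ qE.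
    by rewrite leq0n add0n leqnn.
  have -> : e v0 *: p = r 0%N *: q'.
    apply/eqP; rewrite -subr_eq0; apply/eqP/dI.
    by rewrite linearB qE -q'E subrr.
  exact: in_rad_scale.
have xp : x *: p = 0.
  apply: dI; rewrite linearZ /=; have [y ->] := dp.
  by rewrite scaler_sumr big1 // => i _; rewrite scalerA xa scale0r.
have [z /xz[y yE]|y yE] := projective_annihilator (r := x) (e := e v) (s := a)
  (Pproj D.+1) _ xp.
  by exists y.
by exists y.
Qed.

Lemma resolution_bound (M : lmodType A) n :
  has_proj_resolution M n -> has_proj_resolution M (minn n D).
Proof.
apply: shorten_resolutions => {}M P d f res PD; have [Pproj _ _ _] := res.
exact: (split_mod_rad rad_ideal rad_semisimple sum_vertices rad_nilpotent
  (Pproj D) (last_map_minimal res PD)).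
Qed.

End UpperBound.

(** * Minimal resolutions and their length *)

Section MinimalResolution.
Variables (A : pzRingType) (r s : nat -> A) (T : lmodType A) (u : {linear T -> A^o}).

Hypothesis u_inj : injective u.
Hypothesis u_image : forall x, (exists z, u z = x) <-> exists y, x = y * r 0%N.
Hypothesis s_idem : forall t, s t * s t = s t.
Hypothesis r_source : forall t, s t * r t = r t.
Hypothesis r_target : forall t, r t.+1 * s t = r t.+1.
Hypothesis r_complex : forall t, r t.+1 * r t = 0.
Hypothesis r_exact : forall t z, z * r t = 0 -> exists y, z * s t = y * r t.+1.

Lemma mulr_linear (c : A) : exists f : {linear A^o -> A^o}, forall x, f x = x * c.
Proof.
apply: linear_of => b x y.
by rewrite -[LHS]/((b * x + y) * c) mulrDl -mulrA.
Qed.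

(** The t-th term is A s_t, realized as the fixed points of right multiplication by [s t]; the
    differentials are right multiplications by [r t.+1], and [r 0] gives the cover of [T]. *)
Lemma explicit_resolution N : (forall t, (N < t)%N -> s t = 0) ->
  has_proj_resolution T N.
Proof.
move=> sN.
have /choice[P] t : exists (P : lmodType A) (i : {linear P -> A^o}),
    injective i /\ forall x, x = x * s t <-> exists p, i p = x.
  apply: submodule_of => [|b x y xE yE]; first by rewrite mul0r.
  by rewrite -[RHS]/((b * x + y) * s t) mulrDl -mulrA -xE -yE.
move=> /dependent_choice[i iP].
have iI t : injective (i t) by case: (iP t).
have iE t x : x = x * s t <-> exists p, i t p = x by case: (iP t).
have i_s t p : i t p * s t = i t p by apply/esym/iE; exists p.
have [d dE] : exists d : forall t, {linear P t.+1 -> P t},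
    forall t x, i t (d t x) = i t.+1 x * r t.+1.
  apply: (@dependent_choice _ _ (fun t (d : {linear P t.+1 -> P t}) =>
    forall x, i t (d x) = i t.+1 x * r t.+1)) => t; have [f fE] := mulr_linear (r t.+1).
  have gL : linear (fun x => f (i t.+1 x)) by move=> b x y; rewrite !linearP.
  have [g gE] := linear_of gL.
  have [|l lE] := factor_inj (h := g) (iI t).
    by move=> x; apply/iE; rewrite gE fE -mulrA r_target.
  by exists l => x; rewrite lE gE fE.
have [e eE] : exists e : {linear P 0 -> T}, forall x, u (e x) = i 0%N x * r 0%N.
  have [f fE] := mulr_linear (r 0%N).
  have gL : linear (fun x => f (i 0%N x)) by move=> b x y; rewrite !linearP.
  have [g gE] := linear_of gL.
  have [|l lE] := factor_inj (h := g) u_inj.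
    by move=> x; apply/u_image; exists (i 0%N x); rewrite gE fE.
  by exists l => x; rewrite lE gE fE.
have lift t x : i t x * r t = 0 -> exists y, d t y = x.
  move=> /r_exact[y yE].
  have /iE[z zE] : y * s t.+1 = y * s t.+1 * s t.+1 by rewrite -mulrA s_idem.
  by exists z; apply: iI; rewrite dE zE -mulrA r_source -yE i_s.
exists P, d, e; split.
- move=> t; have /iE[p pE] : s t = s t * s t by rewrite s_idem.
  apply: (principal_projective (iI t) pE (s_idem t)) => x.
  by exists (i t x); rewrite i_s.
- move=> x; have [y yE] : exists y, u x = y * r 0%N by apply/u_image; exists x.
  have /iE[p pE] : y * s 0%N = y * s 0%N * s 0%N by rewrite -mulrA s_idem.
  by exists p; apply: u_inj; rewrite eE pE -mulrA r_source.
- move=> x; split=> [ex|[y <-]]; first by apply: lift; rewrite -eE ex linear0.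
  by apply: u_inj; rewrite eE dE -mulrA r_complex mulr0 linear0.
- move=> t x; split=> [dx|[y <-]]; first by apply: lift; rewrite -dE dx linear0.
  by apply: iI; rewrite !dE -mulrA r_complex mulr0 linear0.
- by move=> t /sN s0 x; apply: iI; rewrite -i_s s0 mulr0 linear0.
Qed.

(** The explicit resolution is compared with [P] in both directions: [p] stands for the image in
    [P t] of the generator s_t, [q] for that of the next generator, and [g] maps back to A s_t. The
    composite is homotopic to the identity, and [r t * y + y' * r t.+1] is the homotopy term at s_t.
    In degree N both [P N] and [r N.+1] vanish, which forces s_N into r_N A. *)
Lemma resolution_length_ge N n : (n < N)%N -> r N.+1 = 0 ->
  (forall y, r N * y <> s N) -> ~ has_proj_resolution T n.
Proof.
move=> nN rN rs [P [d [e [Pproj es e0 dE Pn]]]].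
suff inv t : exists (p : P t) (q : P t.+1) (g : {linear P t -> A^o}) (y y' : A),
   [/\ d t q = r t.+1 *: p, forall x, (g x : A) * s t = g x,
      forall x, (g (d t x) : A) * r t = 0
    & g p = s t + r t * y + y' * r t.+1].
  have [p [_ [g [y [y' [_ _ _]]]]]] := inv N.
  rewrite (Pn N nN p) linear0 rN mulr0 addr0 => /esym/eqP.
  by rewrite addr_eq0 => /eqP sE; apply: (rs (- y)); rewrite mulrN sE.
have restrict (Q : lmodType A) (g : {linear Q -> A^o}) c :
    exists g' : {linear Q -> A^o}, forall x, g' x = (g x : A) * c.
  have [f fE] := mulr_linear c.
  have gL : linear (fun x => f (g x)) by move=> b x y; rewrite !linearP.
  by have [g' g'E] := linear_of gL; exists g' => x; rewrite g'E fE.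
elim: t => [|t [p [q [g [y [y' [qE gs gr gp]]]]]]].
  have [tau tauE] : exists z, u z = r 0%N by apply/u_image; exists 1; rewrite mul1r.
  have [p pE] := es tau.
  have [q qE] : exists q, d 0%N q = r 1%N *: p.
    apply/e0; apply: u_inj; rewrite linearZ /= pE linearZ /= tauE linear0.
    exact: r_complex.
  have [f fE] := mulr_linear (r 0%N).
  have idL : linear (idfun : T -> T) by [].
  have [g0 g0E] : exists g : {linear P 0%N -> A^o},
      forall x, (g x : A) * r 0%N = u (e x).
    have [|g gE] := projective_lift (f := f) (g := u) (h := e) (Pproj 0%N).
      by move=> x; have [z zE] : exists z, u (e x) = z * r 0%N;
        [apply/u_image; exists (e x) | exists z; rewrite fE zE].
    by exists g => x; rewrite -fE gE.
  have [g gE] := restrict _ g0 (s 0%N).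
  have gr x : (g x : A) * r 0%N = u (e x) by rewrite gE -mulrA r_source g0E.
  have [y' y'E] : exists y', (g p - 1 : A) * s 0%N = y' * r 1%N.
    by apply: r_exact; rewrite mulrBl gr pE tauE mul1r subrr.
  have gs x : (g x : A) * s 0%N = g x by rewrite gE -mulrA s_idem.
  exists p, q, g, 0, y'; split=> //.
    move=> x; rewrite gr; have -> : e (d 0%N x) = 0 by apply/e0; exists x.
    exact: linear0.
  by rewrite mulr0 addr0 -y'E mulrBl mul1r gs addrC subrK.
have [q' q'E] : exists q', d t.+1 q' = r t.+2 *: q.
  by apply/dE; rewrite linearZ /= qE scalerA r_complex scale0r.
have [f fE] := mulr_linear (r t.+1).
have [g0 g0E] : exists g' : {linear P t.+1 -> A^o},
    forall x, (g' x : A) * r t.+1 = g (d t x).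
  have [|g' g'E] := projective_lift (f := f) (g := g) (h := d t) (Pproj t.+1).
    by move=> x; have [z zE] := r_exact (gr x); exists z; rewrite fE -zE gs.
  by exists g' => x; rewrite -fE g'E.
have [g' g'E] := restrict _ g0 (s t.+1).
have g'r x : (g' x : A) * r t.+1 = g (d t x) by rewrite g'E -mulrA r_source g0E.
have g's x : (g' x : A) * s t.+1 = g' x by rewrite g'E -mulrA s_idem.
(* By linearity [g' q * r t.+1] equals [r t.+1 * g p]. There the term with [y] dies, while [y']
   survives and becomes the left half of the next homotopy term. *)
have [y2 y2E] : exists y2, (g' q - 1 - r t.+1 * y' : A) * s t.+1 = y2 * r t.+2.
  apply: r_exact; rewrite !mulrBl g'r qE linearZ /= gp mul1r.
  rewrite -[r t.+1 *: _]/(r t.+1 * (s t + r t * y + y' * r t.+1)) !mulrDr r_target.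
  by rewrite mulrA r_complex mul0r addr0 mulrA addrAC addrK subrr.
exists q, q', g', (y' * s t.+1), y2; split=> //.
  move=> x; rewrite g'r; have -> : d t (d t.+1 x) = 0 by apply/dE; exists x.
  exact: linear0.
by rewrite -y2E !mulrBl g's mul1r mulrA -[_ - _ - _]addrA -opprD [RHS]addrC subrK.
Qed.

End MinimalResolution.

(** * Coefficients in a path algebra *)

Section PathFunctionals.
Variables (k : fieldType) (Q : quiver) (T : eqType) (tag : arrow Q -> T).
Local Notation R := (path_algebra k Q).
Local Notation elt := (@path_elt k Q).
Local Notation vert v := (elt (vertex_path v)).

Lemma path_elt_mul p q : elt p * elt q = path_mul k p q.
Proof. exact: pa_mul_elt. Qed.

Lemma pa_scaleAl c (x y : R) : (c *: x) * y = c *: (x * y).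
Proof. exact: pa_mulZl. Qed.

Lemma pa_scaleAr c (x y : R) : x * (c *: y) = c *: (x * y).
Proof. exact: pa_mulZr. Qed.

Lemma pa_oneE : (1 : R) = \sum_v vert v.
Proof. by []. Qed.

Lemma vertex_mul u v : vert u * vert v = if u == v then vert v else 0 :> R.
Proof. by rewrite path_elt_mul /path_mul path_comp1p; case: eqP. Qed.

Lemma vertex_arrow u a :
  vert u * arrow_elt k a = if u == source a then arrow_elt k a else 0.
Proof. by rewrite path_elt_mul /path_mul path_comp1p; case: eqP. Qed.

Lemma arrow_vertex u a :
  arrow_elt k a * vert u = if target a == u then arrow_elt k a else 0.
Proof. by rewrite path_elt_mul /path_mul path_compp1; case: eqP. Qed.

(** Paths from [v] with equal tags are not distinguished: their coefficients are added. If the tag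
    identifies two parallel arrows, the functional therefore vanishes on differences of paths that
    exchange them. *)
Definition path_coef (v : vertex Q) (w : seq T) : R -> k^o :=
  lin_ext (fun p => ((path_source p == v) && (map tag (val p).2 == w))%:R : k^o).

HB.instance Definition _ v w := GRing.Linear.on (path_coef v w).

Lemma path_coefP v w c x y :
  path_coef v w (c *: x + y) = c * path_coef v w x + path_coef v w y.
Proof. exact: linearP. Qed.

Lemma path_coef0 v w : path_coef v w 0 = 0.
Proof. exact: linear0. Qed.

Lemma path_coef_elt v w p :
  path_coef v w (elt p) = ((path_source p == v) && (map tag (val p).2 == w))%:R.
Proof. exact: lin_ext_elt. Qed.

Lemma path_coef_vertex v w u x :
  path_coef v w (vert u * x) = if u == v then path_coef v w x else 0.
Proof.
elim/path_algebra_ind: x => [c x y IHx IHy||p].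
- by rewrite mulrDr pa_scaleAr !path_coefP IHx IHy; case: ifP; rewrite ?mulr0 ?addr0.
- by rewrite mulr0 path_coef0 if_same.
rewrite path_elt_mul /path_mul path_comp1p.
have [->|up] /= := eqVneq u (path_source p).
  by rewrite !path_coef_elt; case: (_ == v).
rewrite path_coef0 path_coef_elt; have [<-|//] := eqVneq u v.
by rewrite eq_sym (negPf up).
Qed.

Lemma path_comp_arrow a p : path_comp (arrow_path a) p =
  if target a == path_source p then (insub (source a, a :: (val p).2) : option (qpath Q))
  else None.
Proof. by []. Qed.

Lemma path_coef_arrow v w a x : path_coef v w (arrow_elt k a * x) =
  if w is l :: w' then
    if (source a == v) && (tag a == l) then path_coef (target a) w' x else 0
  else 0.
Proof.
elim/path_algebra_ind: x => [c x y IHx IHy||p].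
- rewrite mulrDr pa_scaleAr !path_coefP IHx IHy.
  case: w {IHx IHy} => [|l w]; first by rewrite mulr0 addr0.
  by rewrite path_coefP; case: ifP; rewrite ?mulr0 ?addr0.
- by rewrite mulr0 path_coef0; case: w => // l w; rewrite path_coef0 if_same.
rewrite path_elt_mul /path_mul path_comp_arrow.
case: p => -[u s] us; rewrite /path_source /=; case: (eqVneq (target a) u) => [tu|ntu].
  have c : chain (source a) (a :: s) by rewrite /= eqxx tu.
  rewrite insubT /= path_coef_elt /= /path_source /=.
  case: w => [|l w]; first by rewrite andbF.
  by rewrite eqseq_cons andbA path_coef_elt /path_source /= tu eqxx; case: ifP.
rewrite path_coef0; case: w => // l w; rewrite path_coef_elt /path_source /=.
by rewrite [u == _]eq_sym (negPf ntu) if_same.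
Qed.

Lemma path_elt_cons u a s (us : chain (u, a :: s).1 (u, a :: s).2) :
  exists ts : chain (target a, s).1 (target a, s).2,
    elt (exist _ (u, a :: s) us) = arrow_elt k a * elt (exist _ (target a, s) ts).
Proof.
have /= /andP[/eqP ua ts] := us; exists ts.
rewrite path_elt_mul /path_mul path_comp_arrow eqxx /= insubT; first by rewrite /= eqxx.
by move=> c /=; congr elt; apply: val_inj; rewrite /= ua.
Qed.

(** A path of positive length contributes nothing to the empty word, so this coefficient is the
    character of the path algebra at the vertex v. *)
Lemma path_coef_nilM v x y :
  path_coef v [::] (x * y) = path_coef v [::] x * path_coef v [::] y.
Proof.
elim/path_algebra_ind: x => [c x1 x2 IH1 IH2||p].
- by rewrite mulrDl pa_scaleAl !path_coefP IH1 IH2 mulrDl -mulrA.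
- by rewrite mul0r path_coef0 mul0r.
case: p => -[u [|a s]] us.
  have -> : exist _ (u, [::]) us = vertex_path u by apply: val_inj.
  rewrite path_coef_vertex path_coef_elt /path_source /= andbT.
  by case: eqP => _; rewrite ?mul1r ?mul0r.
have [ts ->] := path_elt_cons us.
by rewrite -mulrA !path_coef_arrow mul0r.
Qed.

Lemma path_coef_nil1 v : path_coef v [::] 1 = 1.
Proof.
rewrite pa_oneE linear_sum (bigD1 v) //= big1 ?addr0.
  by rewrite path_coef_elt /path_source /= eqxx.
by move=> u /negPf uv; rewrite path_coef_elt /path_source /= uv.
Qed.

Lemma pa_decomposition x : exists y : arrow Q -> R,
  x = \sum_v (path_coef v [::] x : k) *: vert v + \sum_a arrow_elt k a * y a.
Proof.
elim/path_algebra_ind: x => [c x1 x2 [y1 E1] [y2 E2]||p].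
- exists (fun a => c *: y1 a + y2 a); rewrite {1}E1 {1}E2.
  rewrite scalerDr addrACA; congr (_ + _).
    rewrite scaler_sumr -big_split; apply: eq_bigr => v _.
    by rewrite path_coefP scalerDl scalerA.
  rewrite scaler_sumr -big_split; apply: eq_bigr => a _.
  by rewrite mulrDr pa_scaleAr.
- exists (fun=> 0); rewrite !big1 ?addr0 // => [a _|v _]; first by rewrite mulr0.
  by rewrite path_coef0 scale0r.
case: p => -[u [|a s]] us.
  have -> : exist _ (u, [::]) us = vertex_path u by apply: val_inj.
  exists (fun=> 0); rewrite [X in _ + X]big1 ?addr0; last by move=> a _; rewrite mulr0.
  rewrite (bigD1 u) //= big1 ?addr0.
    by rewrite path_coef_elt /path_source /= !eqxx scale1r.
  by move=> v /negPf vu; rewrite path_coef_elt /path_source /= eq_sym vu scale0r.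
have [ts ->] := path_elt_cons us.
exists (fun b => if b == a then elt (exist _ (target a, s) ts) else 0).
rewrite big1 ?add0r => [|v _]; last by rewrite path_coef_arrow scale0r.
rewrite (bigD1 a) //= eqxx big1 ?addr0 // => b /negPf->.
by rewrite mulr0.
Qed.

(* Left multiplication by c strips the tags s. *)
Definition strips (c : R) (s : seq T) : Prop := forall v w,
  (forall x, path_coef v w (c * x) = 0) \/
  exists v' w', w = s ++ w' /\ forall x, path_coef v w (c * x) = path_coef v' w' x.

Lemma strips_mul c d s t : strips c s -> strips d t -> strips (c * d) (s ++ t).
Proof.
move=> sc sd v w; have [c0|[v1 [w1 [wE cE]]]] := sc v w.
  by left=> x; rewrite -mulrA c0.
have [d0|[v2 [w2 [w1E dE]]]] := sd v1 w1.
  by left=> x; rewrite -mulrA cE d0.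
right; exists v2, w2; split=> [|x]; last by rewrite -mulrA cE dE.
by rewrite wE w1E catA.
Qed.

Lemma strips1 : strips 1 [::].
Proof. by move=> v w; right; exists v, w; split=> // x; rewrite mul1r. Qed.

Lemma strips0 s : strips 0 s.
Proof. by move=> v w; left=> x; rewrite mul0r path_coef0. Qed.

Lemma strips_arrow a : strips (arrow_elt k a) [:: tag a].
Proof.
move=> v [|l w]; first by left=> x; rewrite path_coef_arrow.
have [/andP[/eqP sv /eqP al]|no] := boolP ((source a == v) && (tag a == l)).
  by right; exists (target a), w; split=> [|x];
    rewrite ?path_coef_arrow -?al // sv !eqxx.
by left=> x; rewrite path_coef_arrow (negPf no).
Qed.

Lemma strips_path p : strips (elt p) (map tag (val p).2).
Proof.
case: p => -[u s] us; elim: s u us => [|a s IHs] u us /=.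
  have -> : exist _ (u, [::]) us = vertex_path u by apply: val_inj.
  move=> v w; have [->|uv] := eqVneq u v.
    by right; exists v, w; split=> // x; rewrite path_coef_vertex eqxx.
  by left=> x; rewrite path_coef_vertex (negPf uv).
have [ts ->] := path_elt_cons us.
exact: (strips_mul (strips_arrow a) (IHs _ ts)).
Qed.

(** A path of [x] strips a prefix from [w], and then [c] has to strip [s] from what is left; this is
    impossible unless [s] occurs inside [w]. *)
Lemma path_coef_infix v w x c y s :
  strips c s -> ~~ infix s w -> path_coef v w (x * c * y) = 0.
Proof.
move=> cs /negP sw; elim/path_algebra_ind: x => [b x1 x2 IH1 IH2||p].
- by rewrite !mulrDl !pa_scaleAl path_coefP IH1 IH2 mulr0 addr0.
- by rewrite !mul0r path_coef0.
rewrite -mulrA; have [->//|[v1 [w1 [wE ->]]]] := strips_path p v w.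
have [->//|[v2 [w2 [w1E _]]]] := cs v1 w1.
by case: sw; rewrite wE w1E; apply/infixP; exists (map tag (val p).2), w2.
Qed.

Lemma path_coef_mul_ext v w x c d :
  (forall v' w', path_coef v' w' c = path_coef v' w' d) ->
  path_coef v w (x * c) = path_coef v w (x * d).
Proof.
move=> cd; elim/path_algebra_ind: x => [b x1 x2 IH1 IH2||p].
- by rewrite !mulrDl !pa_scaleAl !path_coefP IH1 IH2.
- by rewrite !mul0r.
by have [p0|[v1 [w1 [_ pE]]]] := strips_path p v w; rewrite ?p0 ?pE.
Qed.

End PathFunctionals.

(** The relations identify the two arrows 5 -> 6 in every product with another alpha, so words are
    compared up to exchanging them. *)
Definition norm (l : label) : label := if l is Alpha5 _ then Alpha5 1 else l.

Definition is_alpha (l : label) : bool :=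
  match l with Alpha _ | Alpha5 _ => true | _ => false end.

Definition is_gamma (l : label) : bool := if l is Gamma _ then true else false.

Definition follows (x y : label) : bool := is_alpha x && (is_alpha y || is_gamma y).

Lemma norm_al i : norm (al i) = al i.
Proof. by rewrite /al; case: ifP. Qed.

Lemma is_alpha_al i : is_alpha (al i).
Proof. by rewrite /al; case: ifP. Qed.

Lemma al_inj : injective al.
Proof. by move=> i j; rewrite /al; do 2 case: eqP => [->|_] //; case. Qed.

Lemma sorted_follows s w : all is_alpha s ->
  (w = [::] \/ exists2 j, w = [:: Gamma j] & s != [::]) -> sorted follows (s ++ w).
Proof.
case: s => [|x s] /=; first by move=> _ [->|[j _ //]].
elim: s x => [|y s IHs] x /andP[ax].
  by move=> _ [->|[j -> _]] //=; rewrite /follows ax.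
move=> ys hw; rewrite /= {1}/follows ax; have /andP[-> _] /= := ys.
exact: IHs.
Qed.

(** * The bound quiver algebra *)

Section BoundQuiverAlgebra.
Variables (k : fieldType) (n m : nat).
Hypotheses (n_ge10 : (10 <= n)%N) (n_mult5 : (5 %| n)%N) (m_ge1 : (1 <= m)%N).

Local Notation R := (path_algebra k (Qnm n m)).
Local Notation L := (Lambda_nm k n m).
Local Notation arr := (arr k n m).
Local Notation word := (word k n m).
Local Notation vtx := (vtx n m).
Local Notation labels := (labels n m).
Local Notation arrow := (arrow (Qnm n m)).

Definition tag (a : arrow) : label := norm (val a).

Local Notation path_coef v w := (@path_coef k (Qnm n m) _ tag v w).

(* A sufficient condition for a word to be nonzero in the algebra, with the two
   arrows 5 -> 6 identified; it holds for all words needed in the proof. *)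
Definition good (w : seq label) : Prop :=
  [/\ (size w <= 4)%N, sorted follows w & (al (n - 2) \notin w) \/ (al n \notin w)].

Lemma vtx_inj i j : (1 <= i <= n + m)%N -> (1 <= j <= n + m)%N ->
  vtx i = vtx j -> i = j.
Proof.
move=> hi hj /(congr1 val); rewrite /vtx /= !inordK //; lia.
Qed.

Lemma vtx_surj (v : vertex (Qnm n m)) : exists2 i, (1 <= i <= n + m)%N & v = vtx i.
Proof.
exists v.+1; first by have := ltn_ord v; lia.
by rewrite /vtx /= inord_val.
Qed.

Lemma arrE l : l \in labels -> exists2 a : arrow, val a = l & arr l = arrow_elt k a.
Proof.
move=> lL; exists (SeqSub lL) => //; rewrite /arr.
by rewrite insubT.
Qed.

Lemma arr_val (a : arrow) : arr (val a) = arrow_elt k a.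
Proof. by rewrite /arr valK. Qed.

Lemma arr_notin l : l \notin labels -> arr l = 0.
Proof. by move=> lL; rewrite /arr insubN. Qed.

Lemma strips_arr l : strips tag (arr l) [:: norm l].
Proof.
have [/arrE[a al ->]|/arr_notin->] := boolP (l \in labels); last exact: strips0.
by rewrite -al; exact: strips_arrow.
Qed.

Lemma word_cons l s : word (l :: s) = arr l * word s.
Proof. by rewrite /word big_cons. Qed.

Lemma strips_word s : strips tag (word s) (map norm s).
Proof.
elim: s => [|l s IHs]; first by rewrite /word big_nil; exact: strips1.
by rewrite word_cons -[map _ _]/([:: norm l] ++ map norm s);
  exact: strips_mul (strips_arr l) IHs.
Qed.

Lemma path_coef_word_infix v w x s y : ~~ infix (map norm s) w ->
  path_coef v w (x * word s * y) = 0.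
Proof. exact/path_coef_infix/strips_word. Qed.

Lemma labels_alpha i : (1 <= i <= n)%N -> al i \in labels.
Proof.
move=> hi; rewrite /al /labels !mem_cat; case: eqP => [_|/eqP i5].
  by rewrite !inE eqxx ?orbT.
rewrite map_f ?mem_filter ?i5 ?mem_iota //=; lia.
Qed.

Lemma labels_alpha5 i : (1 <= i <= 2)%N -> Alpha5 i \in labels.
Proof.
move=> hi; rewrite /labels !mem_cat !inE.
have /orP[/eqP->|/eqP->] : (i == 1)%N || (i == 2)%N by lia.
  by rewrite eqxx !orbT.
by rewrite eqxx !orbT.
Qed.

Lemma path_coef_alpha5 v w x i : (1 <= i <= 2)%N ->
  path_coef v w (arr (Alpha5 i) * x) = path_coef v w (arr (Alpha5 1) * x).
Proof.
move=> hi; have [a ai ->] := arrE (labels_alpha5 hi).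
have [b bi ->] := arrE (labels_alpha5 (isT : 1 <= 1 <= 2)%N).
by rewrite !path_coef_arrow /tag /= ai bi.
Qed.

Lemma good_infix s w : good w -> infix s w -> (size s <= 4)%N /\ sorted follows s.
Proof.
move=> [w4 wf _] sw; split; last exact: infix_sorted sw wf.
exact: leq_trans (size_infix sw) w4.
Qed.

(** Most relations are words that are too long, that continue after an arrow other than an alpha, or
    that pass from an alpha to a loop; no such word lies inside a good one. The relation of length
    three is excluded by the last clause of [good], and the two differences vanish because the tag
    identifies the arrows 5 -> 6. *)
Lemma relations_path_coef v w r x y : good w -> r \in relations k n m ->
  path_coef v w (x * r * y) = 0.
Proof.
move=> gw; have alF i j : follows (norm (al i)) (Lambda j) = false.
  by rewrite norm_al /follows is_alpha_al.
have kill s : (4 < size s)%N || ~~ sorted follows (map norm s) ->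
    path_coef v w (x * word s * y) = 0.
  move=> bad; apply: path_coef_word_infix; apply/negP => /(good_infix gw).
  by rewrite size_map => -[s4 ss]; rewrite ltnNge s4 ss in bad.
rewrite /relations !(mem_cat, inE) -!orbA.
repeat case/orP; try (move=> /eqP->); try (move=> /mapP[i _ ->]);
  try by apply: kill; rewrite ?orbT //= ?alF ?andbF.
- apply: path_coef_word_infix; apply/negP; rewrite /= !norm_al => iw.
  have [_ _ nw] := gw; have /infixP[s1 [s2 wE]] := iw; move: nw.
  by rewrite wE !mem_cat !inE !eqxx !orbT => -[].
- rewrite mulrBr mulrBl -!mulrA !word_cons /word big_nil !mulr1.
  apply/eqP; rewrite linearB subr_eq0; apply/eqP.
  apply: path_coef_mul_ext => v1 w1; rewrite -!mulrA.
  by apply: path_coef_mul_ext => v2 w2; rewrite [RHS]path_coef_alpha5.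
- rewrite mulrBr mulrBl -!mulrA !word_cons /word big_nil !mulr1.
  apply/eqP; rewrite linearB subr_eq0; apply/eqP.
  apply: path_coef_mul_ext => v1 w1; rewrite -!mulrA.
  by rewrite [RHS]path_coef_alpha5.
Qed.

Lemma ideal_path_coef v w x : good w -> x \in ideal_of (relations k n m) ->
  path_coef v w x = 0.
Proof.
move=> gw /ideal_ofP[t tS ->]; rewrite linear_sum big_seq big1 // => u ut.
exact: relations_path_coef gw (tS _ ut).
Qed.

(** * Coefficients in the quotient algebra *)

Definition proj (x : R) : L := quot_pi (relations k n m) x.

Lemma projD x y : proj (x + y) = proj x + proj y.
Proof. exact: quot_piD. Qed.

Lemma projM x y : proj (x * y) = proj x * proj y.
Proof. by apply/esym; exact: quot_piM. Qed.

Lemma proj1 : proj 1 = 1.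
Proof. by []. Qed.

Lemma proj_eq x y : (proj x == proj y) = (x - y \in ideal_of (relations k n m)).
Proof. exact: quot_pi_eq. Qed.

Lemma proj0 : proj 0 = 0.
Proof. by apply: (addrI (proj 0)); rewrite -projD !addr0. Qed.

Lemma projB x y : proj (x - y) = proj x - proj y.
Proof. by apply: (addIr (proj y)); rewrite -projD !subrK. Qed.

Lemma proj_sum (I : Type) (s : seq I) (F : I -> R) :
  proj (\sum_(i <- s) F i) = \sum_(i <- s) proj (F i).
Proof. exact: (big_morph proj projD proj0). Qed.

Lemma proj_surj z : exists x, z = proj x.
Proof. exact: quot_pi_surj. Qed.

Lemma proj_relation r : r \in relations k n m -> proj r = 0.
Proof.
by move=> rS; apply/eqP; rewrite -proj0 proj_eq subr0; exact: ideal_of_gen.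
Qed.

(** For a good word the value does not depend on the representative, since the functional vanishes
    on the ideal; this is where [good] enters the later computations. *)
Definition lcoef v w (z : L) : k := path_coef v w (repr z).

Lemma lcoef_proj v w x : good w -> lcoef v w (proj x) = path_coef v w x.
Proof.
move=> gw; apply/eqP; rewrite -subr_eq0 -[X in X == 0]linearB; apply/eqP.
by apply: ideal_path_coef => //; rewrite -proj_eq /proj /quot_pi reprK.
Qed.

Lemma good_nil : good [::].
Proof. by split=> //; left. Qed.

Lemma good_single l : good [:: l].
Proof.
split=> //; rewrite !inE; case: (eqVneq (al n) l) => [<-|]; last by right.
by left; apply/eqP => /al_inj; lia.
Qed.

Lemma good_suffix s w : good (s ++ w) -> good w.
Proof.
move=> [w4 wf wn]; split.
- by move: w4; rewrite size_cat; lia.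
- by have [] := cat_sorted2 wf.
- by move: wn; rewrite !mem_cat !negb_or => -[/andP[_ ->]|/andP[_ ->]]; [left|right].
Qed.

Definition X l : L := proj (arr l).
Definition E i : L := proj (path_elt k (@vertex_path (Qnm n m) (vtx i))).
Definition W s : L := proj (word s).

Lemma W_cons l s : W (l :: s) = X l * W s.
Proof. by rewrite /W word_cons projM. Qed.

Lemma W_nil : W [::] = 1.
Proof. by rewrite /W /word big_nil. Qed.

Lemma W_cat s t : W (s ++ t) = W s * W t.
Proof.
by elim: s => [|l s IHs]; rewrite ?W_nil ?mul1r // cat_cons !W_cons IHs mulrA.
Qed.

Lemma W_singleton l : W [:: l] = X l.
Proof. by rewrite W_cons W_nil mulr1. Qed.

Lemma lcoefB v w y z : good w -> lcoef v w (y - z) = lcoef v w y - lcoef v w z.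
Proof.
move=> gw; have [x ->] := proj_surj y; have [x' ->] := proj_surj z.
by rewrite -projB !lcoef_proj // linearB.
Qed.

Lemma lcoef0 v w : good w -> lcoef v w 0 = 0.
Proof. by move=> gw; rewrite -proj0 lcoef_proj // path_coef0. Qed.

Lemma lcoef_nilM v y z : lcoef v [::] (y * z) = lcoef v [::] y * lcoef v [::] z.
Proof.
have [x ->] := proj_surj y; have [x' ->] := proj_surj z.
by rewrite -projM !(lcoef_proj _ _ good_nil) path_coef_nilM.
Qed.

Lemma lcoef_E v w i z : good w ->
  lcoef v w (E i * z) = if vtx i == v then lcoef v w z else 0.
Proof.
move=> gw; have [x ->] := proj_surj z.
by rewrite -projM !lcoef_proj // path_coef_vertex.
Qed.

Lemma lcoef_nil_X v l : lcoef v [::] (X l) = 0.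
Proof.
rewrite lcoef_proj; last exact: good_nil.
have [/arrE[a _ ->]|/arr_notin->] := boolP (l \in labels); last exact: path_coef0.
by rewrite -[arrow_elt k a]mulr1 path_coef_arrow.
Qed.

Lemma lcoef_X v l l' w z : l' \in labels -> good (l :: w) ->
  lcoef v (l :: w) (X l' * z) =
  if (vtx (label_source n l') == v) && (norm l' == l)
  then lcoef (vtx (label_target n l')) w z else 0.
Proof.
move=> lL gw; have [x ->] := proj_surj z; rewrite -projM !lcoef_proj //; last first.
  exact: (@good_suffix [:: l]).
have [a al ->] := arrE lL.
by rewrite path_coef_arrow /tag [source a]/= [target a]/= !al.
Qed.

Lemma lcoef_nil_XM v l z : lcoef v [::] (X l * z) = 0.
Proof. by rewrite lcoef_nilM lcoef_nil_X mul0r. Qed.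

Lemma lcoef_sum v w (I : finType) (F : I -> L) : good w ->
  lcoef v w (\sum_i F i) = \sum_i lcoef v w (F i).
Proof.
move=> gw; apply: (big_morph (lcoef v w)); last exact: lcoef0.
move=> y z; have [x ->] := proj_surj y; have [x' ->] := proj_surj z.
by rewrite -projD !lcoef_proj // linearD.
Qed.

Lemma E_X i l : l \in labels ->
  E i * X l = if vtx i == vtx (label_source n l) then X l else 0.
Proof.
move=> /arrE[a al aE]; rewrite /E /X -projM aE vertex_arrow [source a]/= al.
by case: ifP => _; rewrite ?proj0.
Qed.

Lemma X_E i l : l \in labels ->
  X l * E i = if vtx (label_target n l) == vtx i then X l else 0.
Proof.
move=> /arrE[a al aE]; rewrite /E /X -projM aE arrow_vertex [target a]/= al.
by case: ifP => _; rewrite ?proj0.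
Qed.

Lemma E_E i j : E i * E j = if vtx i == vtx j then E j else 0.
Proof. by rewrite /E -projM vertex_mul; case: ifP => _; rewrite ?proj0. Qed.

Definition scalar (c : k) : L := proj (c *: (1 : R)).

Lemma proj_scale c x : proj (c *: x) = scalar c * proj x.
Proof. by rewrite /scalar -projM pa_scaleAl mul1r. Qed.

Lemma lcoef_scalar v c : lcoef v [::] (scalar c) = c.
Proof.
rewrite lcoef_proj; last exact: good_nil.
by rewrite -[c *: (1 : R)]addr0 path_coefP path_coef0 addr0 path_coef_nil1 mulr1.
Qed.

Lemma L_decomposition z : exists y : arrow -> L,
  z = \sum_v scalar (lcoef v [::] z) * proj (path_elt k (vertex_path v)) +
      \sum_a X (val a) * y a.
Proof.
have [x ->] := proj_surj z; have [y {1}->] := pa_decomposition tag x.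
exists (fun a => proj (y a)); rewrite projD !proj_sum; congr (_ + _).
  by apply: eq_bigr => v _; rewrite proj_scale (lcoef_proj _ _ good_nil).
by apply: eq_bigr => a _; rewrite projM /X arr_val.
Qed.

(** * The radical and the semisimple quotient *)

Definition arrow_gen (a : arrow) : L := X (val a).

(** The right ideal generated by the arrows is the common kernel of the characters at the vertices.
    Hence it is two-sided, and membership becomes a computation with coefficients. *)
Lemma in_radP (z : L) :
  in_rad arrow_gen (z : L^o) <-> forall v, lcoef v [::] z = 0.
Proof.
split=> [[y ->] v|z0].
  by rewrite (lcoef_sum _ _ good_nil) big1 // => a _; exact: lcoef_nil_XM.
have [y {1}->] := L_decomposition z; exists y.
rewrite big1 ?add0r // => v _.
by rewrite z0 /scalar scale0r proj0 mul0r.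
Qed.

Definition vert_gen (v : vertex (Qnm n m)) : L := proj (path_elt k (vertex_path v)).

Lemma sum_vert_gen : \sum_v vert_gen v = 1.
Proof. by rewrite -proj1 pa_oneE proj_sum. Qed.

Lemma lcoef_vert u v : lcoef u [::] (vert_gen v) = (v == u)%:R.
Proof.
rewrite lcoef_proj; last exact: good_nil.
by rewrite path_coef_elt /path_source /= andbT.
Qed.

Lemma rad_ideal (b : L) a : in_rad arrow_gen (b * arrow_gen a : L^o).
Proof. by apply/in_radP => v; rewrite lcoef_nilM lcoef_nil_X mulr0. Qed.

Lemma rad_semisimple (b : L) v : in_rad arrow_gen (b * vert_gen v : L^o) \/
  exists b' : L, in_rad arrow_gen (b' * b * vert_gen v - vert_gen v : L^o).
Proof.
have [b0|b0] := eqVneq (lcoef v [::] b) 0; [left | right].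
  apply/in_radP => u; rewrite lcoef_nilM lcoef_vert.
  by case: eqP => [<-|_]; rewrite ?b0 ?mul0r ?mulr0.
exists (scalar (lcoef v [::] b)^-1); apply/in_radP => u.
rewrite (lcoefB _ _ _ good_nil) !lcoef_nilM lcoef_scalar lcoef_vert.
case: eqP => [<-|_]; last by rewrite mulr0 subrr.
by rewrite mulVf // mul1r subrr.
Qed.

(** * Arrows and relations in the quotient *)

Definition loop_vertex i := (1 <= i <= n)%N && ((i %% 5 == 0) || (i %% 5 == 4))%N.

Variant label_spec : label -> Prop :=
  | SpecAlpha i of (1 <= i <= n)%N & i != 5 : label_spec (Alpha i)
  | SpecAlpha5 i of (1 <= i <= 2)%N : label_spec (Alpha5 i)
  | SpecBeta j of (1 <= j <= m)%N : label_spec (Beta j)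
  | SpecGamma j of (1 <= j <= m)%N : label_spec (Gamma j)
  | SpecLoop i of loop_vertex i : label_spec (Lambda i)
  | SpecLambda : label_spec (Lambda (n + m)).

Lemma mem_loop_vertices i : (i \in loop_vertices n) = loop_vertex i.
Proof. by rewrite mem_filter mem_iota add1n ltnS andbC. Qed.

Lemma labelsP l : l \in labels <-> label_spec l.
Proof.
rewrite /labels !mem_cat !inE; split; last first.
  case=> [i hi i5|i hi|j hj|j hj|i hi|].
  - by rewrite map_f // mem_filter i5 mem_iota add1n ltnS.
  - have /orP[/eqP->|/eqP->] : (i == 1)%N || (i == 2)%N by lia.
      by rewrite eqxx !orbT.
    by rewrite eqxx !orbT.
  - by rewrite (map_f Beta) ?orbT // mem_iota add1n ltnS.
  - by rewrite (map_f Gamma) ?orbT // mem_iota add1n ltnS.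
  - by rewrite (map_f Lambda) ?orbT // mem_loop_vertices.
  - by rewrite eqxx !orbT.
case/or4P => [/mapP[i]|/orP[]/eqP->|/mapP[j]|/or3P[/mapP[j]|/mapP[i]|/eqP->]].
- by rewrite mem_filter mem_iota add1n ltnS => /andP[i5 hi] ->; constructor.
- by constructor.
- by constructor.
- by rewrite mem_iota add1n ltnS => hj ->; constructor.
- by rewrite mem_iota add1n ltnS => hj ->; constructor.
- by rewrite mem_loop_vertices => hi ->; constructor.
- by constructor.
Qed.

Lemma mem_catl (T : eqType) (x : T) s t : x \in s -> x \in s ++ t.
Proof. by rewrite mem_cat => ->. Qed.

Lemma mem_catr (T : eqType) (x : T) s t : x \in t -> x \in s ++ t.
Proof. by rewrite mem_cat orbC => ->. Qed.

Lemma mem_behead (T : eqType) (x y : T) s : x \in s -> x \in y :: s.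
Proof. by rewrite in_cons orbC => ->. Qed.

Lemma al_neq5 i : i != 5%N -> al i = Alpha i.
Proof. by rewrite /al => /negPf->. Qed.

Lemma rel_end : W [:: al (n - 2); al (n - 1); al n] = 0.
Proof.
apply: proj_relation; rewrite /relations.
by apply: mem_catl; exact: mem_head.
Qed.

Lemma rel_wrap1 : W [:: al (n - 1); al n; al 1; al 2; al 3] = 0.
Proof.
apply: proj_relation; rewrite /relations.
by apply: mem_catl; apply: mem_behead; exact: mem_head.
Qed.

Lemma rel_wrap0 : W [:: al n; al 1; al 2; al 3; al 4] = 0.
Proof.
apply: proj_relation; rewrite /relations.
by apply: mem_catl; do 2 apply: mem_behead; exact: mem_head.
Qed.

Lemma rel_alpha i : (1 <= i)%N -> (i + 5 <= n)%N ->
  W [:: al i; al (i + 1); al (i + 2); al (i + 3); al (i + 4)] = 0.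
Proof.
move=> i1 i5; apply: proj_relation; rewrite /relations.
apply: mem_catr; apply: mem_catl; apply/mapP; exists i => //.
rewrite mem_iota; lia.
Qed.

Lemma rel_45 : X (al 4) * X (Alpha5 2) = X (al 4) * X (al 5).
Proof.
apply/esym/eqP; rewrite -!W_singleton -!W_cat -subr_eq0 -projB; apply/eqP.
apply: proj_relation; rewrite /relations.
by do 2 apply: mem_catr; apply: mem_catl; exact: mem_head.
Qed.

Lemma rel_56 : X (Alpha5 2) * X (al 6) = X (al 5) * X (al 6).
Proof.
apply/esym/eqP; rewrite -!W_singleton -!W_cat -subr_eq0 -projB; apply/eqP.
apply: proj_relation; rewrite /relations.
by do 2 apply: mem_catr; apply: mem_catl; apply: mem_behead; exact: mem_head.
Qed.

Lemma rel_beta1 : X (Beta 1) * X (al 2) = 0.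
Proof.
rewrite -!W_singleton -W_cat; apply: proj_relation; rewrite /relations.
by do 3 apply: mem_catr; exact: mem_head.
Qed.

Lemma rel_beta j : (1 <= j < m)%N -> X (Beta j.+1) * X (Beta j) = 0.
Proof.
move=> hj; rewrite -!W_singleton -W_cat; apply: proj_relation; rewrite /relations.
do 3 apply: mem_catr.
apply: mem_behead; apply: mem_catl; apply/mapP; exists j.+1; last by rewrite subn1.
rewrite mem_iota; lia.
Qed.

Lemma rel_gamma_beta j : (1 <= j <= m)%N -> X (Gamma j) * X (Beta j) = 0.
Proof.
move=> hj; rewrite -!W_singleton -W_cat; apply: proj_relation; rewrite /relations.
do 3 apply: mem_catr.
apply: mem_behead; apply: mem_catr; apply: mem_catl; apply/mapP; exists j => //.
rewrite mem_iota; lia.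
Qed.

Lemma rel_lambda_gamma j : (1 <= j <= m)%N -> X (Lambda 4) * X (Gamma j) = 0.
Proof.
move=> hj; rewrite -!W_singleton -W_cat; apply: proj_relation; rewrite /relations.
do 3 apply: mem_catr; apply: mem_behead.
do 3 apply: mem_catr; apply: mem_catl.
apply/mapP; exists j => //; rewrite mem_iota; lia.
Qed.

Lemma rel_loop i : loop_vertex i -> X (Lambda i) * X (Lambda i) = 0.
Proof.
move=> hi; rewrite -!W_singleton -W_cat; apply: proj_relation; rewrite /relations.
do 3 apply: mem_catr; apply: mem_behead.
do 4 apply: mem_catr; apply: mem_catl.
by apply/mapP; exists i => //; rewrite mem_loop_vertices.
Qed.

Lemma rel_alpha_loop i : loop_vertex i -> X (al (i - 1)) * X (Lambda i) = 0.
Proof.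
move=> hi; rewrite -!W_singleton -W_cat; apply: proj_relation; rewrite /relations.
do 3 apply: mem_catr; apply: mem_behead.
do 5 apply: mem_catr; apply: mem_catl.
by apply/mapP; exists i => //; rewrite mem_loop_vertices.
Qed.

Lemma rel_loop_alpha i : loop_vertex i -> X (Lambda i) * X (al i) = 0.
Proof.
move=> hi; rewrite -!W_singleton -W_cat; apply: proj_relation; rewrite /relations.
do 3 apply: mem_catr; apply: mem_behead.
do 6 apply: mem_catr; apply: mem_catl.
by apply/mapP; exists i => //; rewrite mem_loop_vertices.
Qed.

Lemma rel_loop5 : X (Lambda 5) * X (Alpha5 2) = 0.
Proof.
rewrite -!W_singleton -W_cat; apply: proj_relation; rewrite /relations.
do 3 apply: mem_catr; apply: mem_behead.
do 7 apply: mem_catr; apply: mem_catl; exact: mem_head. Qed.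

Lemma rel_last_loop : X (Lambda (n + m)) * X (Lambda (n + m)) = 0.
Proof.
rewrite -!W_singleton -W_cat; apply: proj_relation; rewrite /relations.
do 3 apply: mem_catr; apply: mem_behead.
do 8 apply: mem_catr; exact: mem_head. Qed.

Lemma rel_gamma_last : X (Gamma m) * X (Lambda (n + m)) = 0.
Proof.
rewrite -!W_singleton -W_cat; apply: proj_relation; rewrite /relations.
do 3 apply: mem_catr; apply: mem_behead.
do 8 apply: mem_catr; apply: mem_behead; exact: mem_head.
Qed.

Lemma rel_last_beta : X (Lambda (n + m)) * X (Beta m) = 0.
Proof.
rewrite -!W_singleton -W_cat; apply: proj_relation; rewrite /relations.
do 3 apply: mem_catr; apply: mem_behead.
do 8 apply: mem_catr; do 2 apply: mem_behead; exact: mem_head.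
Qed.

Local Notation src := (label_source n).
Local Notation tgt := (label_target n).

Lemma src_range l : l \in labels -> (1 <= src l <= n + m)%N.
Proof. by move=> /labelsP[i|i|j|j|i|] /=; rewrite ?/loop_vertex; lia. Qed.

Lemma tgt_range l : l \in labels -> (1 <= tgt l <= n + m)%N.
Proof.
by move=> /labelsP[i|i|j|j|i|] /=; rewrite ?/loop_vertex; try case: ifP; lia.
Qed.

Lemma X_tgt l : l \in labels -> X l * E (tgt l) = X l.
Proof. by move=> lL; rewrite X_E // eqxx. Qed.

Lemma src_X l : l \in labels -> E (src l) * X l = X l.
Proof. by move=> lL; rewrite E_X // eqxx. Qed.

Lemma E_X0 i l : (1 <= i <= n + m)%N -> l \in labels -> i != src l ->
  E i * X l = 0.
Proof.
move=> hi lL il; rewrite E_X //; case: eqP => // vi; case/eqP: il.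
by apply: vtx_inj vi => //; exact: src_range.
Qed.

Lemma X_X0 l l' : l \in labels -> l' \in labels -> tgt l != src l' -> X l * X l' = 0.
Proof.
by move=> lL l'L tl; rewrite -(X_tgt lL) -mulrA E_X0 ?mulr0 // tgt_range.
Qed.

(** For every arrow other than an alpha, the relations list all arrows that leave its target. Thus
    betas, gammas and loops lie in the right socle. *)
Lemma X_dead l l' : l \in labels -> l' \in labels -> ~~ is_alpha l -> X l * X l' = 0.
Proof.
move=> lL l'L; have [|tl] := boolP (tgt l != src l'); first by move/X_X0->.
move: (lL) (l'L) tl => /labelsP sl /labelsP sl'; rewrite negbK => /eqP tl.
case: sl tl => [//|//|j hj|j hj|i hi|] tl _.
- move: tl => /=; case: ifP => [/eqP->|j1].
    case: sl' => [i hi i5|i hi|i hi|i hi|i|] /=; rewrite ?/loop_vertex; try lia.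
    by move=> i2; have -> : Alpha i = al 2 by [rewrite -i2]; exact: rel_beta1.
  case: sl' => [i hi i5|i hi|i hi|i hi|i|] /=; rewrite ?/loop_vertex; try lia.
  by move=> ij; have -> : j = i.+1 by [lia]; apply: rel_beta; lia.
- case: sl' tl => [i hi i5|i hi|i hi|i hi|i|] /=; rewrite ?/loop_vertex; try lia.
    by move=> ij; have -> : j = i by [lia]; exact: rel_gamma_beta.
  by move=> jm; have -> : j = m by [lia]; exact: rel_gamma_last.
- case: sl' tl => [a ha a5|a ha|a ha|a ha|a ha|] /=;
    move: (hi); rewrite ?/loop_vertex; try lia.
  + by move=> _ ia; rewrite -ia in a5 *; rewrite -(al_neq5 a5) rel_loop_alpha.
  + move=> hi5 i5; have /orP[/eqP->|/eqP->] : (a == 1)%N || (a == 2)%N by lia.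
      by rewrite i5 in hi *; rewrite -[Alpha5 1]/(al 5) rel_loop_alpha.
    by rewrite i5 rel_loop5.
  + by move=> _ ->; rewrite rel_lambda_gamma.
  + by move=> _ ia; rewrite -ia rel_loop.
- case: sl' tl => [a ha a5|a ha|a ha|a ha|a|] /=; rewrite ?/loop_vertex; try lia.
    by move=> am; have -> : a = m by [lia]; exact: rel_last_beta.
  by move=> _; exact: rel_last_loop.
Qed.

(** * Nilpotency of the radical *)

Definition succ i := if i == n then 1%N else i.+1.

Lemma alpha_index l : l \in labels -> is_alpha l ->
  exists i, [/\ (1 <= i <= n)%N, norm l = al i, src l = i & tgt l = succ i].
Proof.
move=> /labelsP[i hi i5|i hi|//|//|//|//] _.
  by exists i; rewrite al_neq5 //= /succ addn1.
by exists 5%N; split=> //; [lia | rewrite /succ; case: eqP => //; lia].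
Qed.

(** An arrow 5 -> 6 composes only with alpha_4 before it and alpha_6 after it among the alphas, and
    these are the two products in which the relations identify the parallel arrows. *)
Lemma X_norm l l' : l \in labels -> l' \in labels -> is_alpha l -> is_alpha l' ->
  X l * X l' = X (norm l) * X (norm l').
Proof.
have a51 : Alpha5 1 \in labels by apply: labels_alpha5.
move=> lL l'L; move: (lL) (l'L) => /labelsP sl /labelsP sl'.
case: sl lL => [i hi i5|i hi|//|//|//|//] lL _;
  case: sl' l'L => [j hj j5|j hj|//|//|//|//] l'L _ //.
- have [->|i4] := eqVneq i 4%N.
    have /orP[/eqP->|/eqP->] // : (j == 1)%N || (j == 2)%N by lia.
    exact: rel_45.
  have t l1 : src l1 = 5%N -> tgt (Alpha i) != src l1.
    by move=> -> /=; case: ifP; lia.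
  rewrite -[norm (Alpha i)]/(Alpha i) -[norm (Alpha5 j)]/(Alpha5 1).
  by rewrite (X_X0 lL l'L (t (Alpha5 j) erefl)) (X_X0 lL a51 (t (Alpha5 1) erefl)).
- have [->|j6] := eqVneq j 6%N.
    have /orP[/eqP->|/eqP->] // : (i == 1)%N || (i == 2)%N by lia.
    exact: rel_56.
  rewrite -[norm (Alpha5 i)]/(Alpha5 1) -[norm (Alpha j)]/(Alpha j).
  by rewrite (X_X0 lL l'L) ?(X_X0 a51 l'L) //= eq_sym.
- by rewrite !X_X0.
Qed.

Lemma norm_label l : l \in labels -> norm l \in labels.
Proof. by case: l => //= i _; apply: labels_alpha5. Qed.

Lemma norm_id l : norm (norm l) = norm l.
Proof. by case: l. Qed.

Lemma is_alpha_norm l : is_alpha (norm l) = is_alpha l.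
Proof. by case: l. Qed.

(** Five alphas starting at i are a relation if i <= n - 5, contain alpha_(n-2) alpha_(n-1) alpha_n
    for the next three values of i, and are the two wrap-around relations for i = n - 1 and i =
    n. *)
Lemma consecutive_alphas i : (1 <= i <= n)%N ->
  W [:: al i; al (succ i); al (succ (succ i)); al (succ (succ (succ i)));
        al (succ (succ (succ (succ i))))] = 0.
Proof.
move=> hi; have S j : (j < n)%N -> succ j = (j + 1)%N.
  by rewrite /succ; case: eqP => //; lia.
have Sn : succ n = 1%N by rewrite /succ eqxx.
have [le|] := leqP (i + 5) n; first by rewrite !S -?addnA ?rel_alpha //; lia.
have [->|x4] := eqVneq i (n - 4)%N.
  move=> _; rewrite !S -?addnA; try lia.
  have -> : (n - 4 + (1 + 1) = n - 2)%N by lia.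
  have -> : (n - 4 + (1 + (1 + 1)) = n - 1)%N by lia.
  have -> : (n - 4 + (1 + (1 + (1 + 1))) = n)%N by lia.
  rewrite -[LHS]/(W ([:: _; _] ++ [:: al (n - 2); al (n - 1); al n])).
  by rewrite W_cat rel_end mulr0.
have [->|x3] := eqVneq i (n - 3)%N.
  rewrite S; last by lia.
  have -> : (n - 3 + 1 = n - 2)%N by lia.
  rewrite S; last by lia.
  have -> : (n - 2 + 1 = n - 1)%N by lia.
  rewrite S; last by lia.
  have -> : (n - 1 + 1 = n)%N by lia.
  rewrite -[W _]/(W ([:: _] ++ [:: al (n - 2); al (n - 1); al n] ++ [:: _])).
  by rewrite !W_cat rel_end mul0r mulr0.
have [->|x2] := eqVneq i (n - 2)%N.
  rewrite S; last by lia.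
  have -> : (n - 2 + 1 = n - 1)%N by lia.
  rewrite S; last by lia.
  have -> : (n - 1 + 1 = n)%N by lia.
  rewrite -[W _]/(W ([:: al (n - 2); al (n - 1); al n] ++ [:: _; _])).
  by rewrite W_cat rel_end mul0r.
have [->|x1] := eqVneq i (n - 1)%N.
  rewrite S; last by lia.
  have -> : (n - 1 + 1 = n)%N by lia.
  rewrite Sn !S //; try lia.
  by move=> _; exact: rel_wrap1.
move=> i_n; have -> : i = n by lia.
rewrite Sn !S //; try lia.
exact: rel_wrap0.
Qed.

Lemma five_alphas l1 l2 l3 l4 l5 :
  all [in labels] [:: l1; l2; l3; l4; l5] -> all is_alpha [:: l1; l2; l3; l4; l5] ->
  W [:: l1; l2; l3; l4; l5] = 0.
Proof.
rewrite /= !andbT => /and5P[L1 L2 L3 L4 L5] /and5P[A1 A2 A3 A4 A5].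
rewrite !W_cons W_nil mulr1.
have [i1 [h1 n1 s1 t1]] := alpha_index L1 A1.
have [i2 [h2 n2 s2 t2]] := alpha_index L2 A2.
have [i3 [h3 n3 s3 t3]] := alpha_index L3 A3.
have [i4 [h4 n4 s4 t4]] := alpha_index L4 A4.
have [i5 [h5 n5 s5 t5]] := alpha_index L5 A5.
have [/eqP|/(X_X0 L1 L2) z] := eqVneq (tgt l1) (src l2); last by rewrite mulrA z mul0r.
have [/eqP|/(X_X0 L2 L3) z] := eqVneq (tgt l2) (src l3); last first.
  by rewrite [X l2 * _]mulrA z mul0r mulr0.
have [/eqP|/(X_X0 L3 L4) z] := eqVneq (tgt l3) (src l4); last first.
  by rewrite [X l3 * _]mulrA z mul0r !mulr0.
have [/eqP|/(X_X0 L4 L5) z] := eqVneq (tgt l4) (src l5); last by rewrite z !mulr0.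
rewrite t1 t2 t3 t4 s2 s3 s4 s5 => /eqP e5 /eqP e4 /eqP e3 /eqP e2.
rewrite mulrA (X_norm L1 L2) // -mulrA [X (norm l2) * _]mulrA.
rewrite (X_norm (norm_label L2) L3) ?is_alpha_norm // -mulrA [X (norm l3) * _]mulrA.
rewrite (X_norm (norm_label L3) L4) ?is_alpha_norm // -mulrA.
rewrite (X_norm (norm_label L4) L5) ?is_alpha_norm //.
rewrite !norm_id n1 n2 n3 n4 n5 -e5 -e4 -e3 -e2.
by have := consecutive_alphas h1; rewrite !W_cons W_nil mulr1.
Qed.

(** An arrow other than an alpha can only be the last factor of a nonzero word. In length six the
    first five factors would then be alphas, and five alphas already vanish. *)
Lemma long_words_vanish (s : seq arrow) : size s = 6%N ->
  \prod_(a <- s) arrow_gen a = 0.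
Proof.
case: s => [|a1 [|a2 [|a3 [|a4 [|a5 [|a6 [|//]]]]]]] // _.
rewrite !big_cons big_nil /arrow_gen mulr1.
have dead a b : ~~ is_alpha (val a) -> X (val (a : arrow)) * X (val (b : arrow)) = 0.
  by move=> na; apply: X_dead => //; apply: valP.
have [A1|/(dead _ a2) z] := boolP (is_alpha (val a1)); last by rewrite mulrA z mul0r.
have [A2|/(dead _ a3) z] := boolP (is_alpha (val a2)); last first.
  by rewrite [X (val a2) * _]mulrA z mul0r mulr0.
have [A3|/(dead _ a4) z] := boolP (is_alpha (val a3)); last first.
  by rewrite [X (val a3) * _]mulrA z mul0r !mulr0.
have [A4|/(dead _ a5) z] := boolP (is_alpha (val a4)); last first.
  by rewrite [X (val a4) * _]mulrA z mul0r !mulr0.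
have [A5|/(dead _ a6) z] := boolP (is_alpha (val a5)); last by rewrite z !mulr0.
have := @five_alphas (val a1) (val a2) (val a3) (val a4) (val a5).
rewrite /= A1 A2 A3 A4 A5 !(valP a1, valP a2, valP a3, valP a4, valP a5).
move=> /(_ isT isT).
rewrite !W_cons W_nil mulr1 => w0.
rewrite [X (val a4) * _]mulrA [X (val a3) * _]mulrA [X (val a2) * _]mulrA.
by rewrite mulrA w0 mul0r.
Qed.

(** * Annihilators of arrows and paths *)

Lemma source_unique i l : (1 <= i <= n)%N ->
  [|| i %% 5 == 1, i %% 5 == 2 | i %% 5 == 3]%N ->
  l \in labels -> src l = i -> l = al i.
Proof.
move=> hi i5 /labelsP[a ha a5|a ha|a ha|a ha|a ha|] /=; rewrite ?/loop_vertex; try lia.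
  by move=> <-; rewrite al_neq5.
by move: ha; rewrite /loop_vertex; lia.
Qed.

Lemma E_idem i : E i * E i = E i.
Proof. by rewrite E_E eqxx. Qed.

Lemma rad_right l y : l \in labels -> ~~ is_alpha l ->
  lcoef (vtx (tgt l)) [::] y = 0 -> X l * y = 0.
Proof.
move=> lL la y0; have /in_radP[z zE] : forall v, lcoef v [::] (E (tgt l) * y) = 0.
  by move=> v; rewrite lcoef_E; [case: eqP => [<-|] | exact: good_nil].
rewrite -(X_tgt lL) -mulrA zE mulr_sumr big1 // => a _.
rewrite -[_ *: _]/(X (val a) * z a) mulrA X_dead ?mul0r //; exact: valP.
Qed.

(* The information on the cofactors of the arrows gamma is needed to discard
   the branches at the vertex 4. *)
Lemma left_expansion (c T : L) v z : (1 <= v <= n + m)%N ->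
  lcoef (vtx v) [::] z = 0 ->
  (forall l, l \in labels -> src l = v -> forall y,
     (is_gamma l -> lcoef (vtx (tgt l)) [::] y = lcoef (vtx v) [:: l] z) ->
     exists y', c * X l * y = T * y') ->
  exists y', c * (E v * z) = T * y'.
Proof.
move=> hv z0 step.
have /in_radP[y yE] : forall u, lcoef u [::] (E v * z) = 0.
  by move=> u; rewrite lcoef_E; [case: eqP => [<-|] | exact: good_nil].
have {}yE : E v * z = \sum_a E v * X (val a) * y a.
  transitivity (E v * (E v * z)); first by rewrite mulrA E_idem.
  rewrite yE mulr_sumr; apply: eq_bigr => a _.
  by rewrite -[_ *: _]/(X (val a) * y a) mulrA.
have /choice[y' y'E] (a : arrow) : exists y', c * (E v * X (val a) * y a) = T * y'.
  have aL := valP a; have [sa|sa] := eqVneq (src (val a)) v; last first.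
    by exists 0; rewrite E_X0 1?eq_sym // mul0r !mulr0.
  rewrite -sa src_X // mulrA; apply: step => // ag.
  have gl : good [:: val a] by exact: good_single.
  have := lcoef_E (vtx v) v z gl; rewrite eqxx => <-.
  rewrite yE (lcoef_sum _ _ gl) (bigD1 a) //= big1 ?addr0.
    rewrite -sa src_X // lcoef_X // eqxx.
    have -> : norm (val a) = val a by case: (val a) ag.
    by rewrite [X in _ && X]eqxx.
  move=> b ba; rewrite -mulrA lcoef_E // eqxx lcoef_X //; last exact: valP.
  case: andP => // -[_ /eqP nb]; case/eqP: ba; apply: val_inj.
  have bg : is_gamma (norm (val b)) by rewrite nb.
  have norm_gamma l : is_gamma (norm l) -> norm l = l by case: l.
  exact: etrans (esym (norm_gamma _ bg)) nb.
exists (\sum_a y' a); rewrite yE !mulr_sumr; apply: eq_bigr => a _; exact: y'E.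
Qed.

Definition seg i l : seq label := [seq al j | j <- iota i l].

Lemma seg_rcons i l : seg i l.+1 = rcons (seg i l) (al (i + l)).
Proof. by rewrite /seg -addn1 iotaD map_cat cats1. Qed.

Lemma W_seg_rcons i l : W (seg i l.+1) = W (seg i l) * X (al (i + l)).
Proof. by rewrite seg_rcons -cats1 W_cat W_singleton. Qed.

Lemma tgt_al i : (1 <= i < n)%N -> tgt (al i) = i.+1.
Proof. by rewrite /al => hi; case: eqP => [->|_] //=; case: eqP; lia. Qed.

Lemma src_al i : src (al i) = i.
Proof. by rewrite /al; case: eqP. Qed.

Lemma alL i : (1 <= i <= n)%N -> al i \in labels.
Proof. exact: labels_alpha. Qed.

Lemma W_seg_E i l : (1 <= i)%N -> (1 <= l)%N -> (i + l <= n)%N ->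
  W (seg i l) * E (i + l) = W (seg i l).
Proof.
case: l => // l i1 _ il; rewrite W_seg_rcons -mulrA.
have -> : (i + l.+1 = tgt (al (i + l)))%N by rewrite tgt_al; lia.
by rewrite X_tgt // alL; lia.
Qed.

Lemma lcoef_al i w z : (1 <= i <= n)%N -> good (al i :: w) ->
  lcoef (vtx i) (al i :: w) (X (al i) * z) = lcoef (vtx (tgt (al i))) w z.
Proof. by move=> hi gw; rewrite lcoef_X ?alL // src_al norm_al !eqxx. Qed.

Lemma lcoef_seg i l w z : (1 <= i)%N -> (i + l <= n)%N -> good (seg i l ++ w) ->
  lcoef (vtx i) (seg i l ++ w) (W (seg i l) * z) = lcoef (vtx (i + l)) w z.
Proof.
elim: l i => [|l IHl] i i1 il; first by rewrite /= W_nil mul1r addn0.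
move=> gw; rewrite [seg i l.+1]/= W_cons -mulrA lcoef_al ?tgt_al //; try lia.
rewrite addnS -addSn; apply: IHl => //; first by lia.
exact: (@good_suffix [:: al i]).
Qed.

Lemma good_seg i l w : (i + l <= n)%N -> (l + size w <= 4)%N ->
  (w = [::] \/ exists2 j, w = [:: Gamma j] & 0 < l)%N -> good (seg i l ++ w).
Proof.
move=> il l4 hw.
have nal : al n \notin seg i l.
  by apply/mapP => -[j]; rewrite mem_iota => hj /al_inj nj; lia.
split; first by rewrite size_cat size_map size_iota.
- apply: sorted_follows.
    by apply/allP => x /mapP[j _ ->]; exact: is_alpha_al.
  by case: hw => [->|[j -> l0]]; [left | right; exists j => //; case: (l) l0].
right; rewrite mem_cat (negPf nal) /=.
by case: hw => [->|[j -> _]] //; rewrite inE /al; case: ifP.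
Qed.

(** The path is lengthened by one alpha at a time. Beyond the first step, loops die after the
    preceding alpha, the second arrow 5 -> 6 is identified with the first, and the gammas at the
    vertex 4 are discarded by looking at coefficients. *)
Lemma exact_alpha i l z : (1 <= i)%N -> ((i %% 5 == 1) || (i %% 5 == 2))%N ->
  (l <= 4)%N -> (i + l <= n)%N -> X (al i) * z = 0 ->
  exists y, E i.+1 * z = W (seg i.+1 l) * y.
Proof.
move=> i1 i5 l4 il xz; elim: l l4 il => [|l IHl] l4 il.
  by exists (E i.+1 * z); rewrite W_nil mul1r.
have [||y yE] := IHl; try lia.
(* The coefficient of [w] in the cofactor is that of the word prolonged to the left by alpha_i, ...,
   alpha_(i+l), read in alpha_i z = 0. *)
have key w : good (seg i l.+1 ++ w) -> lcoef (vtx (i.+1 + l)) w y = 0.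
  move=> gw; have gw' : good (seg i.+1 l ++ w) by exact: (@good_suffix [:: al i]).
  rewrite -(lcoef_seg (i := i.+1)) -?yE //; last by lia.
  rewrite lcoef_E // eqxx.
  have -> : vtx i.+1 = vtx (tgt (al i)) by rewrite tgt_al //; lia.
  rewrite -(lcoef_al (i := i)) //; last by lia.
  by rewrite xz; exact: lcoef0.
have gseg : good (seg i l.+1 ++ [::]) by apply: good_seg => //=; [lia | left].
have y0 := key [::] gseg.
have hv : (1 <= i.+1 + l <= n + m)%N by lia.
have [l0|l0] := posnP l.
  rewrite l0 addn0 in y0 hv *.
  have [l' l'L sl' u _|u uE] := left_expansion (c := 1) (T := X (al i.+1)) hv y0.
    by exists u; rewrite mul1r (source_unique _ _ l'L sl') //; lia.
  exists u; rewrite W_singleton -uE mul1r yE l0 W_nil mul1r.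
  have -> : y = E i.+1 * z by rewrite yE l0 W_nil mul1r.
  by rewrite mulrA E_idem.
have [l1 l1E] : exists l1, l = l1.+1 by exists l.-1; lia.
have cE : W (seg i.+1 l) * E (i.+1 + l) = W (seg i.+1 l) by apply: W_seg_E; lia.
have last_al : W (seg i.+1 l) = W (seg i.+1 l1) * X (al (i + l)).
  by rewrite l1E W_seg_rcons addSnnS.
rewrite yE -cE -mulrA; apply: left_expansion => // l' l'L.
move: (l'L) => /labelsP sl'.
case: sl' l'L => [a ha a5|a ha|a ha|a ha|a ha|] l'L /= sa u uz; try lia.
- by exists u; rewrite W_seg_rcons -sa al_neq5.
- exists u; congr (_ * _); rewrite W_seg_rcons -sa.
  have /orP[/eqP->//|/eqP->] : (a == 1)%N || (a == 2)%N by lia.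
  have il4 : (i + l = 4)%N by lia.
  by rewrite last_al il4 -!mulrA rel_45.
(* [key] for the one-letter word gamma shows that the cofactor of gamma has no constant term at its
   target, and gamma kills such an element. *)
- exists 0; rewrite mulr0 -mulrA rad_right ?mulr0 //=; rewrite uz //.
  apply: key; apply: good_seg => //=; try lia.
  by right; exists a.
- exists 0; rewrite mulr0 last_al -(mulrA _ (X (al _))).
  have -> : (i + l = a - 1)%N by lia.
  by rewrite rel_alpha_loop // mulr0 mul0r.
Qed.

Lemma kill_lcoef l z : l \in labels -> X l * z = 0 ->
  lcoef (vtx (tgt l)) [::] z = 0.
Proof.
move=> lL xz.
have := @lcoef_X (vtx (src l)) (norm l) l [::] z lL (good_single (norm l)).
by rewrite !eqxx xz /= => <-; apply: lcoef0; exact: good_single.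
Qed.

Lemma exact_arrow i l z : (1 <= i <= n + m)%N ->
  (forall l', l' \in labels -> src l' = i -> l' = l) ->
  lcoef (vtx i) [::] z = 0 -> exists y, E i * z = X l * y.
Proof.
move=> hi unique z0.
have [l' l'L sl' u _|y yE] := left_expansion (c := 1) (T := X l) hi z0.
  by exists u; rewrite mul1r (unique _ l'L sl').
by exists y; rewrite -yE mul1r.
Qed.

Lemma exact_seg i z : (1 <= i)%N -> ((i %% 5 == 1) || (i %% 5 == 2))%N ->
  (i + 5 <= n)%N -> W (seg i.+1 4) * z = 0 ->
  exists y, E (i + 5) * z = X (al (i + 5)) * y.
Proof.
move=> i1 i5 il wz; apply: exact_arrow; first by lia.
  by move=> l lL sl; apply: source_unique lL sl; lia.
have gs : good (seg i.+1 4 ++ [::]) by apply: good_seg => //; [lia | left].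
have -> : (i + 5 = i.+1 + 4)%N by lia.
by rewrite -(lcoef_seg (i := i.+1)) ?wz ?lcoef0 //; lia.
Qed.

Lemma betaL j : (1 <= j <= m)%N -> Beta j \in labels.
Proof. by move=> hj; apply/labelsP; constructor. Qed.

Lemma exact_beta j z : (1 <= j <= m)%N -> X (Beta j) * z = 0 ->
  exists y, E (tgt (Beta j)) * z =
    X (if j == 1%N then al 2 else Beta (j - 1)) * y.
Proof.
move=> hj xz; apply: exact_arrow; last by apply: kill_lcoef (betaL hj) xz.
  exact/tgt_range/betaL.
move=> l lL; rewrite /=; case: eqP => [_ sl|j1 sl].
  by apply: source_unique lL sl; lia.
case/labelsP: lL sl => [a ha a5|a ha|a ha|a ha|a ha|] /=; try lia.
- by move=> aj; congr Beta; lia.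
- by move: ha; rewrite /loop_vertex; lia.
Qed.

Lemma W_seg5 i : (1 <= i)%N -> (i + 5 <= n)%N -> W (seg i 5) = 0.
Proof.
move=> i1 il; have := rel_alpha i1 il.
by rewrite addn1 addn2 addn3 addn4.
Qed.

(** Such an x generates a copy of the simple right module at i. The last clause expresses x <> 0:
    what x annihilates has no constant term at i. *)
Definition left_socle_vertex (i : nat) (x : L) : Prop :=
  [/\ x * E i = x, forall l, l \in labels -> src l = i -> x * X l = 0
    & forall z, x * z = 0 -> lcoef (vtx i) [::] z = 0].

Lemma dead_arrow_socle l : l \in labels -> ~~ is_alpha l ->
  left_socle_vertex (tgt l) (X l).
Proof.
move=> lL la; split=> [|l' l'L _|z]; first exact: X_tgt.
  exact: X_dead.
exact: kill_lcoef.
Qed.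

(** Four alphas ending at 3 have to wrap around the cycle. The path starts at n - 1 and so avoids
    alpha_(n-2), which makes it good although it contains alpha_n. *)
Lemma socle_vertex3 :
  left_socle_vertex 3 (W [:: al (n - 1); al n; al 1; al 2]).
Proof.
have aL i : (1 <= i <= n)%N -> al i \in labels by exact: alL.
have tn : tgt (al n) = 1%N by rewrite /al; case: eqP => [|_] /=; rewrite ?eqxx //; lia.
split.
- rewrite !W_cons W_nil mulr1 -!mulrA.
  have -> : 3%N = tgt (al 2) by rewrite tgt_al //; lia.
  by rewrite X_tgt // aL; lia.
- move=> l lL sl; rewrite (source_unique _ _ lL sl) //; last by lia.
  by rewrite -W_singleton -W_cat rel_wrap1.
move=> z; rewrite !W_cons W_nil mulr1 -!mulrA => xz.
have g : good [:: al (n - 1); al n; al 1; al 2].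
  split=> //.
    rewrite -[X in sorted _ X]cats0; apply: sorted_follows; last by left.
    by rewrite /= !is_alpha_al.
  left; rewrite !inE !(inj_eq al_inj); lia.
have g1 : good [:: al n; al 1; al 2] by exact: (@good_suffix [:: _]) g.
have g2 : good [:: al 1; al 2] by exact: (@good_suffix [:: _]) g1.
have g3 : good [:: al 2] by exact: good_single.
have := lcoef0 (vtx (n - 1)) g; rewrite -xz lcoef_al ?tgt_al //; try lia.
have -> : (n - 1).+1 = n by lia.
rewrite lcoef_al // ?tn; last by lia.
by rewrite lcoef_al ?tgt_al // ?lcoef_al ?tgt_al //; lia.
Qed.

Lemma seg_socle i : (6 <= i <= n)%N ->
  [|| i %% 5 == 1, i %% 5 == 2 | i %% 5 == 3]%N ->
  left_socle_vertex i (W (seg (i - 4) 4)).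
Proof.
move=> hi i5; have i4 : (i - 4 + 4 = i)%N by lia.
split.
- by rewrite -[in E i]i4 W_seg_E //; lia.
- move=> l lL sl; rewrite (source_unique _ i5 lL sl); last by lia.
  by rewrite -[in al i]i4 -W_seg_rcons W_seg5 //; lia.
move=> z wz; have gs : good (seg (i - 4) 4 ++ [::]).
  by apply: good_seg => //; [lia | left].
by rewrite -[in vtx i]i4 -(lcoef_seg (i := i - 4)) ?wz ?lcoef0 //; lia.
Qed.

(** Vertices above n are reached by gammas, 2 by beta_1, vertices congruent to 0 or 4 modulo 5 by
    their loops, and the others by paths of four alphas. At the vertex 1 such a path would end in
    the relation of length three. *)
Lemma socle_vertex_exists i : (1 <= i <= n + m)%N -> i != 1%N ->
  exists x, left_socle_vertex i x.
Proof.
move=> hi i1; have [gt_in|le_in] := ltnP n i.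
  have gL : Gamma (i - n) \in labels by apply/labelsP; constructor; lia.
  have := dead_arrow_socle gL isT; rewrite /= subnKC; last by lia.
  by exists (X (Gamma (i - n))).
have [i2|i2] := eqVneq i 2%N.
  have bL : Beta 1 \in labels by apply: betaL.
  by rewrite i2; exists (X (Beta 1)); exact: dead_arrow_socle bL isT.
have [->|i3] := eqVneq i 3%N; first by eexists; exact: socle_vertex3.
have [lv|lv] := boolP (loop_vertex i).
  have lL : Lambda i \in labels by apply/labelsP; constructor.
  by exists (X (Lambda i)); exact: dead_arrow_socle lL isT.
by eexists; apply: seg_socle; move: lv; rewrite /loop_vertex; lia.
Qed.

Lemma socle (v : vertex (Qnm n m)) : v != vtx 1 -> exists x : L,
  [/\ x * vert_gen v = x, forall a, x * arrow_gen a = 0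
    & forall z, x * z = 0 -> in_rad arrow_gen (vert_gen v * z : L^o)].
Proof.
have [i hi ->] := vtx_surj v; move=> i1.
have [||x [xE xX xz]] := @socle_vertex_exists i; first by [].
  by apply: contra_neq i1 => ->.
exists x; split=> // [a|z /xz z0].
  have [sa|sa] := eqVneq i (src (val a)); first by apply: xX => //; exact: valP.
  by rewrite -xE -mulrA E_X0 ?mulr0 //; exact: valP.
apply/in_radP => u; rewrite [vert_gen _ * z]/(E i * z) lcoef_E; last exact: good_nil.
by case: eqP => [<-|].
Qed.

(** * Resolutions of the simple right modules at 1 and 2 and of beta_m L *)

Local Notation D := (2 * (n %/ 5) - 1)%N.

(* For b = 1, 2, left multiplication by the terms of this sequence resolves the
   simple right module at the vertex b, whose projective dimension is D. *)
Definition rseq b t : L :=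
  if (t < D)%N then
    if odd t then W (seg (5 * t./2 + b).+1 4) else X (al (5 * t./2 + b))
  else 0.

Definition sseq b t : L :=
  if (t < D)%N then
    E (if odd t then 5 * t./2 + b + 5 else (5 * t./2 + b).+1)%N
  else 0.

Section Sequence.
Variable b : nat.
Hypothesis hb : ((b == 1) || (b == 2))%N.

Lemma rseq_target t : rseq b t * sseq b t = rseq b t.
Proof.
rewrite /rseq /sseq; case: ltnP => tD; last by rewrite mul0r.
case: ifP => ot.
  have -> : (5 * t./2 + b + 5 = (5 * t./2 + b).+1 + 4)%N by lia.
  by rewrite W_seg_E //; lia.
have -> : ((5 * t./2 + b).+1 = tgt (al (5 * t./2 + b)))%N by rewrite tgt_al //; lia.
by rewrite X_tgt // alL; lia.
Qed.

Lemma rseq_source t : sseq b t * rseq b t.+1 = rseq b t.+1.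
Proof.
rewrite /rseq; case: (ltnP t.+1) => tD; last by rewrite mulr0.
rewrite /sseq ltnW //=; case: ifP => ot /=.
  rewrite -[LHS]/(E (5 * t./2 + b + 5) * X (al (5 * t.+1./2 + b))).
  have -> : (5 * t.+1./2 + b = 5 * t./2 + b + 5)%N by lia.
  have := @src_X (al (5 * t./2 + b + 5)); rewrite src_al; apply; apply: alL; lia.
rewrite uphalf_half ot add0n.
rewrite W_cons mulrA; congr (_ * _).
have := @src_X (al (5 * t./2 + b).+1); rewrite src_al; apply; apply: alL; lia.
Qed.

Lemma rseq_complex t : rseq b t * rseq b t.+1 = 0.
Proof.
rewrite /rseq; case: (ltnP t.+1) => tD; last by rewrite mulr0.
rewrite ltnW //=; case: ifP => ot /=.
  rewrite -[LHS]/(W (seg (5 * t./2 + b).+1 4) * X (al (5 * t.+1./2 + b))).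
  have -> : (5 * t.+1./2 + b = (5 * t./2 + b).+1 + 4)%N by lia.
  by rewrite -W_seg_rcons W_seg5 //; lia.
rewrite uphalf_half ot add0n.
rewrite -W_cons -[X in W X]/(seg (5 * t./2 + b) 5) W_seg5 //; lia.
Qed.

Lemma rseq_exact t z : rseq b t * z = 0 ->
  exists y, sseq b t * z = rseq b t.+1 * y.
Proof.
rewrite {1}/rseq /sseq; case: ltnP => tD; last by exists 0; rewrite mul0r mulr0.
have i1 : (1 <= 5 * t./2 + b)%N by lia.
have i5 : (((5 * t./2 + b) %% 5 == 1) || ((5 * t./2 + b) %% 5 == 2))%N by lia.
case: ifP => ot rz.
  have il : (5 * t./2 + b + 5 <= n)%N by lia.
  have [y yE] := exact_seg i1 i5 il rz.
  (* D is odd, so an odd t < D is never the last index. *)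
  exists y; rewrite yE /rseq ifT; last by lia.
  rewrite /= ot /=; congr (X (al _) * _); lia.
have [tD1|tD1] := ltnP t.+1 D.
  have il : (5 * t./2 + b + 4 <= n)%N by lia.
  have [y yE] := exact_alpha i1 i5 (isT : 4 <= 4)%N il rz.
  exists y; rewrite yE /rseq tD1 /= ot /=.
  by rewrite uphalf_half ot add0n.
(* At t = D - 1 the arrow is alpha_(n-5+b), and 5 - b alphas remain up to alpha_n. As b <= 2 there
   are at least three of them, so their product contains the relation of length three and is
   zero. *)
have b4 : (5 - b <= 4)%N by lia.
have il : (5 * t./2 + b + (5 - b) <= n)%N by lia.
have [y yE] := exact_alpha i1 i5 b4 il rz.
exists 0; rewrite mulr0 yE.
suff -> : W (seg (5 * t./2 + b).+1 (5 - b)) = 0 by rewrite mul0r.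
have [b1|b2] := orP hb; [move/eqP: b1 => b1 | move/eqP: b2 => b1].
  have -> : (5 - b = 4)%N by lia.
  set c := (5 * t./2 + b)%N.
  rewrite -[seg _ _]/[:: al c.+1; al c.+2; al c.+3; al c.+4] W_cons.
  have -> : (c.+4 = n)%N by rewrite /c; lia.
  have -> : (c.+3 = n - 1)%N by rewrite /c; lia.
  have -> : (c.+2 = n - 2)%N by rewrite /c; lia.
  by rewrite rel_end mulr0.
have -> : (5 - b = 3)%N by lia.
set c := (5 * t./2 + b)%N.
rewrite -[seg _ _]/[:: al c.+1; al c.+2; al c.+3].
have -> : (c.+3 = n)%N by rewrite /c; lia.
have -> : (c.+2 = n - 1)%N by rewrite /c; lia.
have -> : (c.+1 = n - 2)%N by rewrite /c; lia.
exact: rel_end.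
Qed.

End Sequence.

(* The resolution of beta_m L, a simple right module. *)
Definition beta_seq t : L := if (t < m)%N then X (Beta (m - t)) else rseq 2 (t - m).
Definition beta_target t : L :=
  if (t < m)%N then E (tgt (Beta (m - t))) else sseq 2 (t - m).

Lemma rseq0 b : rseq b 0 = X (al b).
Proof. by rewrite /rseq ifT /= ?muln0 ?add0n //; lia. Qed.

Lemma beta_target_idem t : beta_target t * beta_target t = beta_target t.
Proof.
rewrite /beta_target; case: ifP => _; first exact: E_idem.
by rewrite /sseq; case: ifP => _; rewrite ?mulr0 // E_idem.
Qed.

Lemma beta_seq_target t : beta_seq t * beta_target t = beta_seq t.
Proof.
rewrite /beta_seq /beta_target; case: ltnP => tm; last exact: rseq_target.
by rewrite X_tgt // betaL //; lia.
Qed.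

Lemma beta_seq_succ t : (t < m)%N -> beta_seq t.+1 =
  X (if m - t == 1 then al 2 else Beta (m - t - 1))%N.
Proof.
rewrite /beta_seq => tm; case: ltnP => t1m; last first.
  have -> : (t.+1 - m = 0)%N by lia.
  by rewrite rseq0 ifT //; lia.
by rewrite ifF; [congr (X (Beta _)) | ]; lia.
Qed.

Lemma beta_seq_source t : beta_target t * beta_seq t.+1 = beta_seq t.+1.
Proof.
have [tm|mt] := ltnP t m; last first.
  rewrite /beta_target /beta_seq !ltnNge mt leqW // subSn //=.
  exact: rseq_source.
rewrite beta_seq_succ // /beta_target tm /=; case: eqP => mt1.
  by have := @src_X (al 2); rewrite src_al; apply; apply: alL; lia.
have := @src_X (Beta (m - t - 1)); rewrite /= addnBA; last by lia.
by apply; apply: betaL; lia.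
Qed.

Lemma beta_seq_complex t : beta_seq t * beta_seq t.+1 = 0.
Proof.
have [tm|mt] := ltnP t m; last first.
  rewrite /beta_seq !ltnNge mt leqW // subSn //=.
  exact: rseq_complex.
rewrite beta_seq_succ // /beta_seq tm; case: eqP => [->|mt1].
  exact: rel_beta1.
have -> : (m - t = (m - t - 1).+1)%N by lia.
by rewrite subSS subn0 rel_beta //; lia.
Qed.

Lemma beta_seq_exact t z : beta_seq t * z = 0 ->
  exists y, beta_target t * z = beta_seq t.+1 * y.
Proof.
have [tm|mt] := ltnP t m; last first.
  rewrite /beta_target /beta_seq !ltnNge mt leqW // subSn //=.
  exact: rseq_exact.
rewrite beta_seq_succ // /beta_target /beta_seq tm; apply: exact_beta; lia.
Qed.

Lemma lcoef_rseq b t v : lcoef v [::] (rseq b t) = 0.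
Proof.
rewrite /rseq; case: ifP => _; last exact/lcoef0/good_nil.
by case: ifP => _; [rewrite W_cons lcoef_nil_XM | exact: lcoef_nil_X].
Qed.

Local Notation N := (m + D - 1)%N.

Lemma beta_seq_last : beta_seq N.+1 = 0.
Proof. by rewrite /beta_seq /rseq ifF ?ifF //; lia. Qed.

Lemma beta_target_above t : (N < t)%N -> beta_target t = 0.
Proof. by move=> Nt; rewrite /beta_target /sseq ifF ?ifF //; lia. Qed.

(** The last map has its entry in the radical, whereas a vertex idempotent has constant term 1 at
    its vertex. *)
Lemma beta_seq_minimal y : y * beta_seq N <> beta_target N.
Proof.
rewrite /beta_seq /beta_target ifF; last by lia.
rewrite ifF; last by lia.
rewrite /sseq ifT; last by lia.
move: (if _ then _ else _) => i yE.
have := lcoef_vert (vtx i) (vtx i).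
rewrite -[vert_gen _]/(E i) -yE lcoef_nilM lcoef_rseq mulr0 eqxx.
by move=> /esym/eqP; rewrite oner_eq0.
Qed.

End BoundQuiverAlgebra.

(** * Finitistic dimensions *)

Section Dimensions.
Variable A : pzRingType.
Local Open Scope ereal_scope.

Lemma proj_dim_ge (M : lmodType A) N :
  (forall n, (n < N)%N -> ~ has_proj_resolution M n) -> N%:Z%:E <= proj_dim M.
Proof.
move=> noM; rewrite /proj_dim /infimum; case: ifPn => [_|/set0P ne].
  (* Without a finite resolution the infimum is the default value [+oo]. *)
  by rewrite leey.
have low x : [set n%:Z%:E | n in has_proj_resolution M]%classic x -> N%:Z%:E <= x.
  move=> [n Mn <-]; rewrite lee_fin lez_nat leqNgt; apply/negP => nN.
  exact: noM nN Mn.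
have [_ glb] := xgetPex +oo (eint_infimums_neq0 ne
  (fun x Sx => le_trans (lee_fin 0 N%:Z : 0 <= N%:Z%:E) (low x Sx))).
exact: glb.
Qed.

Lemma proj_dim_le (M : lmodType A) n :
  has_proj_resolution M n -> proj_dim M <= n%:Z%:E.
Proof.
move=> Mn; apply: le_infimum_Nmem; last by exists n.
by apply: eint_infimums_neq0 => [|_ [j _ <-]]; [exists n%:Z%:E, n | rewrite lee_fin].
Qed.

Lemma proj_dim_lty (M : lmodType A) :
  proj_dim M < +oo -> exists n, has_proj_resolution M n.
Proof.
rewrite /proj_dim /infimum; case: ifPn => [_|/set0P[_ [n Mn _]] _].
  by rewrite ltxx.
by exists n.
Qed.

Lemma Fin_dim_le D :
  (forall (M : lmodType A) n, has_proj_resolution M n ->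
     has_proj_resolution M (minn n D)) ->
  Fin_dim A <= D%:Z%:E.
Proof.
move=> shorten; rewrite /Fin_dim /supremum; case: ifPn => [_|/set0P ne].
  by rewrite leNye.
have up d : [set d | exists2 M : lmodType A, proj_dim M < +oo & d = proj_dim M]%classic d ->
    0 <= d /\ d <= D%:Z%:E.
  move=> [M /proj_dim_lty[n Mn] ->]; split.
    by apply: (@proj_dim_ge M 0).
  apply: (le_trans (proj_dim_le (shorten M n Mn))).
  by rewrite lee_fin lez_nat geq_minr.
have [_ lub] := xgetPex -oo (eint_supremums_neq0 ne (fun d Sd => (up d Sd).1)).
by apply: lub => d Sd; exact: (up d Sd).2.
Qed.

Lemma fin_dim_ge (M : lmodType A) N n : finitely_generated M ->
  has_proj_resolution M n ->
  (forall j, (j < N)%N -> ~ has_proj_resolution M j) -> N%:Z%:E <= fin_dim A.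
Proof.
move=> fgM Mn noM; apply: (le_trans (proj_dim_ge noM)).
have SM : [set d | exists2 M : lmodType A,
    finitely_generated M /\ proj_dim M < +oo & d = proj_dim M]%classic (proj_dim M).
  by exists M => //; split=> //; apply: (le_lt_trans (proj_dim_le Mn)); rewrite ltey.
apply: ge_supremum_Nmem => //; apply: eint_supremums_neq0; first by exists (proj_dim M).
by move=> _ [M' _ ->]; apply: (@proj_dim_ge M' 0).
Qed.

End Dimensions.

Lemma left_Fin_dim_le (k : fieldType) (n m : nat) :
  (10 <= n)%N -> (5 %| n)%N -> (1 <= m)%N ->
  (Fin_dim (Lambda_nm k n m) <= (2 * (n %/ 5) - 1)%N%:Z%:E)%E.
Proof.
move=> n10 n5 m1; apply: Fin_dim_le => M d.
have one : ((1 == 1) || (1 == 2))%N by [].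
(* Words of length 6 vanish, and the sequence starts at the vertex 1, the one for which [socle]
   provides no element. *)
apply: (@resolution_bound _ _ _ (@arrow_gen k n m) (@vert_gen k n m) 6 _ _ _ _
  (vtx n m 1) (@rseq k n m 1) (@sseq k n m 1)).
- exact: rad_ideal.
- exact: rad_semisimple.
- exact: sum_vert_gen.
- exact: long_words_vanish.
- by rewrite /rseq ltnn.
- by move=> t _; exact: rseq_complex.
- by move=> t _; exact: rseq_target.
- by move=> t z _; exact: rseq_exact.
- by rewrite rseq0 //; apply/in_radP => // v; exact: lcoef_nil_X.
- move=> a; have [sa|sa] := eqVneq (label_source n (val a)) 1%N; last first.
    exists 0; rewrite mulr0; apply: E_X0 => //; [lia | exact: valP | by rewrite eq_sym].
  exists 1; rewrite mulr1 rseq0 // /arrow_gen.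
  have <- : val a = al 1.
    by apply: (source_unique n10 n5 m1 _ _ (valP a) sa); lia.
  by rewrite -[vert_gen _ _]/(E k n m 1) -sa src_X //; exact: valP.
- exact: socle.
Qed.

Lemma right_fin_dim_ge (k : fieldType) (n m : nat) :
  (10 <= n)%N -> (5 %| n)%N -> (1 <= m)%N ->
  ((m + (2 * (n %/ 5) - 1) - 1)%N%:Z%:E <= fin_dim (Lambda_nm k n m)^c)%E.
Proof.
move=> n10 n5 m1; set N := (m + _ - 1)%N.
pose A : pzRingType := (Lambda_nm k n m)^c.
pose r : nat -> A := beta_seq k n m.
pose s : nat -> A := beta_target k n m.
have [||T [u [uI uT]]] := @submodule_of A A^o (fun x => exists y : A, x = y * r 0%N).
- by exists 0; rewrite mul0r.
- move=> b _ _ [y1 ->] [y2 ->]; exists (b * y1 + y2).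
  by rewrite mulrDl -mulrA.
have uTr x : (exists z, u z = x) <-> exists y, x = y * r 0%N.
  by split=> /uT.
(* Products in [A] are those of the algebra with the factors exchanged, so each condition holds by
   conversion, with sources and targets interchanged. *)
have s_idem t : s t * s t = s t by exact: beta_target_idem.
have r_source t : s t * r t = r t by exact: beta_seq_target.
have r_target t : r t.+1 * s t = r t.+1 by exact: beta_seq_source.
have r_complex t : r t.+1 * r t = 0 by exact: beta_seq_complex.
have r_exact t z : z * r t = 0 -> exists y, z * s t = y * r t.+1.
  exact: beta_seq_exact.
apply: (@fin_dim_ge A T N N).
- have [g gE] : exists g, u g = r 0%N by apply/uTr; exists 1; rewrite mul1r.
  exists [:: g] => x; have [y yE] : exists y, u x = y * r 0%N by apply/uTr; exists x.
  exists (fun=> y); rewrite big_seq1; apply: uI.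
  by rewrite linearZ /= gE.
- apply: (explicit_resolution uI uTr s_idem r_source r_target r_complex r_exact) => t.
  exact: beta_target_above.
- move=> j jN; apply: (resolution_length_ge uI uTr s_idem r_source r_target
    r_complex r_exact jN); first exact: beta_seq_last.
  exact: beta_seq_minimal.
Qed.

Theorem corollary4p16 (k : fieldType) (n m : nat) (n_ge10 : (10 <= n)%N)
  (n_mult5 : (5 %| n)%N) (m_ge1 : (1 <= m)%N) :
  ((m%:Z - 1)%:E <=
     fin_dim (Lambda_nm k n m)^c - Fin_dim (Lambda_nm k n m))%E.
Proof.
(* With D = 2n/5 - 1 the two bounds differ by (m + D - 1) - D = m - 1. *)
have := leeB (right_fin_dim_ge k n_ge10 n_mult5 m_ge1)
             (left_Fin_dim_le k n_ge10 n_mult5 m_ge1).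
apply: le_trans; rewrite -EFinB lee_fin; lia.
Qed.
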